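(* There is a sequence of cut-free ${\bf L}\varepsilon$-proofs $\psi_i$ ($i<\omega$) with end-sequents $S_i$ such that: (1) the size of $S_i$ is polynomial in $i$; (2) each $S_i$ is the epsilon translation $[S'_i]^\varepsilon$ of a first-order sequent $S'_i$ containing weak quantifiers only; (3) the size of $\psi_i$ is polynomially bounded in $i$; (4) there is no bound on the size of the smallest cut-free ${\bf LK}$-proofs of $S'_i$ (the translation of $S_i$ back to first-order language) that is elementary in $i$.
   Context: ${\bf LK}$ is Gentzen's classical first-order sequent calculus. The size of a sequent or proof is the number of symbol occurrences in it; a function on the naturals is elementary if definable by a quantifier-free formula from $+$, $\times$, $x\mapsto 2^x$. Epsilon language: terms built from variables, function symbols and epsilon terms $\varepsilon_x A(x)$; formulas are quantifier-free, built from atoms with $\land,\lor,\to,\neg$. The epsilon translation of a first-order formula: $[A]^\varepsilon=A$ for atoms; it commutes with $\land,\lor,\to,\neg$; $[\exists x A'(x)]^\varepsilon=[A'(\varepsilon_x A'(x))]^\varepsilon$; $[\forall x A'(x)]^\varepsilon=[A'(\varepsilon_x\neg A'(x))]^\varepsilon$; on sequents it acts formulawise. ${\bf L}\varepsilon$ is the sequent calculus over the epsilon language with atomic axioms $A\vdash A$, the ${\bf LK}$ rules for $\land,\lor,\to,\neg$ (context-splitting binary rules), weakening, contraction, cut, and the quantifier inferences $\exists_r$: from $\Pi\vdash\Delta,A(t)$ infer $\Pi\vdash\Delta,A(\varepsilon_x A(x))$; $\forall_l$: from $A(t),\Pi\vdash\Delta$ infer $A(\varepsilon_x\neg A(x)),\Pi\vdash\Delta$;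 there are no strong quantifier rules. A cut-free ${\bf L}\varepsilon$-proof is one without cut. A quantifier occurrence in a first-order sequent is strong if it is universal in positive position or existential in negative position (positive positions: succedent, flipped by negation and implication antecedent; antecedent of the sequent counts as negative); otherwise it is weak. *)

(* Defs.v *)
From Stdlib Require Import Permutation.
From mathcomp Require Import all_boot ssralg poly.

Set Implicit Arguments.
Unset Strict Implicit.
Unset Printing Implicit Defensive.

(** Variables are de Bruijn indices: index 0 below a binder is the variable
    bound by it, and loose indices are the free variables.  A function or
    predicate symbol is a pair of a name and an arity, the arity being the
    length of the argument list: there are countably many symbols of every
    arity, and the same name used with two lengths denotes two symbols. *)

Inductive fterm : Type :=
| Var (n : nat)
| Fn (f : nat) (ts : seq fterm).

Inductive fform : Type :=
| Atom (p : nat) (ts : seq fterm)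
| Neg (A : fform)
| And (A B : fform)
| Or (A B : fform)
| Imp (A B : fform)
| All (A : fform)
| Ex (A : fform).

Fixpoint tsubst (s : nat -> fterm) (t : fterm) : fterm :=
  match t with
  | Var n => s n
  | Fn f ts => Fn f (map (tsubst s) ts)
  end.

Definition tshift : fterm -> fterm := tsubst (fun n => Var n.+1).

Definition tup (s : nat -> fterm) (n : nat) : fterm :=
  if n is m.+1 then tshift (s m) else Var 0.

Fixpoint fsubst (s : nat -> fterm) (A : fform) : fform :=
  match A with
  | Atom p ts => Atom p (map (tsubst s) ts)
  | Neg A => Neg (fsubst s A)
  | And A B => And (fsubst s A) (fsubst s B)
  | Or A B => Or (fsubst s A) (fsubst s B)
  | Imp A B => Imp (fsubst s A) (fsubst s B)
  | All A => All (fsubst (tup s) A)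
  | Ex A => Ex (fsubst (tup s) A)
  end.

Definition fshift : fform -> fform := fsubst (fun n => Var n.+1).

(** [inst A t] is A(t), where A(x) is the body of a quantifier on x. *)
Definition inst (A : fform) (t : fterm) : fform :=
  fsubst (fun n => if n is m.+1 then Var m else t) A.

Inductive eterm : Type :=
| EVar (n : nat)
| EFn (f : nat) (ts : seq eterm)
| Eps (A : eform)
with eform : Type :=
| EAtom (p : nat) (ts : seq eterm)
| ENeg (A : eform)
| EAnd (A B : eform)
| EOr (A B : eform)
| EImp (A B : eform).

Definition upren (r : nat -> nat) (n : nat) : nat :=
  if n is m.+1 then (r m).+1 else 0.

Fixpoint etren (r : nat -> nat) (t : eterm) : eterm :=
  match t with
  | EVar n => EVar (r n)
  | EFn f ts => EFn f (map (etren r) ts)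
  | Eps A => Eps (efren (upren r) A)
  end
with efren (r : nat -> nat) (A : eform) : eform :=
  match A with
  | EAtom p ts => EAtom p (map (etren r) ts)
  | ENeg A => ENeg (efren r A)
  | EAnd A B => EAnd (efren r A) (efren r B)
  | EOr A B => EOr (efren r A) (efren r B)
  | EImp A B => EImp (efren r A) (efren r B)
  end.

Definition eup (s : nat -> eterm) (n : nat) : eterm :=
  if n is m.+1 then etren succn (s m) else EVar 0.

Fixpoint etsubst (s : nat -> eterm) (t : eterm) : eterm :=
  match t with
  | EVar n => s n
  | EFn f ts => EFn f (map (etsubst s) ts)
  | Eps A => Eps (efsubst (eup s) A)
  end
with efsubst (s : nat -> eterm) (A : eform) : eform :=
  match A with
  | EAtom p ts => EAtom p (map (etsubst s) ts)
  | ENeg A => ENeg (efsubst s A)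
  | EAnd A B => EAnd (efsubst s A) (efsubst s B)
  | EOr A B => EOr (efsubst s A) (efsubst s B)
  | EImp A B => EImp (efsubst s A) (efsubst s B)
  end.

Definition einst (A : eform) (t : eterm) : eform :=
  efsubst (fun n => if n is m.+1 then EVar m else t) A.

Definition sequent (F : Type) : Type := (seq F * seq F)%type.

Definition map_sequent (F G : Type) (h : F -> G) (S : sequent F) : sequent G :=
  (map h S.1, map h S.2).

(** Every occurrence of a variable, function, predicate or logical symbol
    counts 1, so a binder contributes 2 (the operator and its variable), and
    the sequent arrow counts 1; parentheses and commas are not counted. *)
Definition sequent_size (F : Type) (sz : F -> nat) (S : sequent F) : nat :=
  (sumn (map sz S.1) + sumn (map sz S.2)).+1.

Fixpoint fterm_size (t : fterm) : nat :=
  match t with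
  | Var _ => 1
  | Fn _ ts => (sumn (map fterm_size ts)).+1
  end.

Fixpoint fform_size (A : fform) : nat :=
  match A with
  | Atom _ ts => (sumn (map fterm_size ts)).+1
  | Neg A => (fform_size A).+1
  | And A B | Or A B | Imp A B => (fform_size A + fform_size B).+1
  | All A | Ex A => (fform_size A).+2
  end.

Fixpoint eterm_size (t : eterm) : nat :=
  match t with
  | EVar _ => 1
  | EFn _ ts => (sumn (map eterm_size ts)).+1
  | Eps A => (eform_size A).+2
  end
with eform_size (A : eform) : nat :=
  match A with
  | EAtom _ ts => (sumn (map eterm_size ts)).+1
  | ENeg A => (eform_size A).+1
  | EAnd A B | EOr A B | EImp A B => (eform_size A + eform_size B).+1
  end.

Fixpoint eps_term (t : fterm) : eterm :=
  match t with
  | Var n => EVar n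
  | Fn f ts => EFn f (map eps_term ts)
  end.

(** Translation commutes with substitution, so translating A'(eps_x A'(x)),
    including the copies of A' inside the epsilon term, amounts to
    substituting in the translation of A'. *)
Fixpoint eps_form (A : fform) : eform :=
  match A with
  | Atom p ts => EAtom p (map eps_term ts)
  | Neg A => ENeg (eps_form A)
  | And A B => EAnd (eps_form A) (eps_form B)
  | Or A B => EOr (eps_form A) (eps_form B)
  | Imp A B => EImp (eps_form A) (eps_form B)
  | Ex A => einst (eps_form A) (Eps (eps_form A))
  | All A => einst (eps_form A) (Eps (ENeg (eps_form A)))
  end.

Definition eps_sequent : sequent fform -> sequent eform := map_sequent eps_form.

(** [weak_only pos A]: no quantifier occurrence of A is strong, when A itself
    stands in positive ([pos = true]) or negative ([pos = false]) position. *)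
Fixpoint weak_only (pos : bool) (A : fform) : bool :=
  match A with
  | Atom _ _ => true
  | Neg A => weak_only (~~ pos) A
  | And A B | Or A B => weak_only pos A && weak_only pos B
  | Imp A B => weak_only (~~ pos) A && weak_only pos B
  | All A => ~~ pos && weak_only pos A
  | Ex A => pos && weak_only pos A
  end.

Definition weak_quantifiers_only (S : sequent fform) : bool :=
  all (weak_only false) S.1 && all (weak_only true) S.2.

(** The permutation rule is Gentzen's exchange (any number of exchanges at
    once); because of it, principal formulas are put at the head of the list
    on both sides. *)
Inductive LK : sequent fform -> Type :=
| LK_ax A : LK ([:: A], [:: A])
| LK_exch G G' D D' :
    Permutation G G' -> Permutation D D' -> LK (G, D) -> LK (G', D')
| LK_wl A G D : LK (G, D) -> LK (A :: G, D)
| LK_wr A G D : LK (G, D) -> LK (G, A :: D)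
| LK_cl A G D : LK (A :: A :: G, D) -> LK (A :: G, D)
| LK_cr A G D : LK (G, A :: A :: D) -> LK (G, A :: D)
| LK_cut A G D P L :
    LK (G, A :: D) -> LK (A :: P, L) -> LK (G ++ P, D ++ L)
| LK_negl A G D : LK (G, A :: D) -> LK (Neg A :: G, D)
| LK_negr A G D : LK (A :: G, D) -> LK (G, Neg A :: D)
| LK_andl1 A B G D : LK (A :: G, D) -> LK (And A B :: G, D)
| LK_andl2 A B G D : LK (B :: G, D) -> LK (And A B :: G, D)
| LK_andr A B G D P L :
    LK (G, A :: D) -> LK (P, B :: L) -> LK (G ++ P, And A B :: D ++ L)
| LK_orl A B G D P L :
    LK (A :: G, D) -> LK (B :: P, L) -> LK (Or A B :: G ++ P, D ++ L)
| LK_orr1 A B G D : LK (G, A :: D) -> LK (G, Or A B :: D)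
| LK_orr2 A B G D : LK (G, B :: D) -> LK (G, Or A B :: D)
| LK_impl A B G D P L :
    LK (G, A :: D) -> LK (B :: P, L) -> LK (Imp A B :: G ++ P, D ++ L)
| LK_impr A B G D : LK (A :: G, B :: D) -> LK (G, Imp A B :: D)
| LK_alll A t G D : LK (inst A t :: G, D) -> LK (All A :: G, D)
(* The eigenvariable is index 0 of the premise, where the context is shifted. *)
| LK_allr A G D : LK (map fshift G, A :: map fshift D) -> LK (G, All A :: D)
| LK_exl A G D : LK (A :: map fshift G, map fshift D) -> LK (Ex A :: G, D)
| LK_exr A t G D : LK (G, inst A t :: D) -> LK (G, Ex A :: D).

Fixpoint LK_size (S : sequent fform) (p : LK S) : nat :=
  sequent_size fform_size S +
  match p with
  | LK_ax _ => 0
  | LK_exch _ _ _ _ _ _ p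
  | LK_wl _ _ _ p | LK_wr _ _ _ p | LK_cl _ _ _ p | LK_cr _ _ _ p
  | LK_negl _ _ _ p | LK_negr _ _ _ p
  | LK_andl1 _ _ _ _ p | LK_andl2 _ _ _ _ p
  | LK_orr1 _ _ _ _ p | LK_orr2 _ _ _ _ p | LK_impr _ _ _ _ p
  | LK_alll _ _ _ _ p | LK_allr _ _ _ p
  | LK_exl _ _ _ p | LK_exr _ _ _ _ p => LK_size p
  | LK_cut _ _ _ _ _ p q
  | LK_andr _ _ _ _ _ _ p q
  | LK_orl _ _ _ _ _ _ p q
  | LK_impl _ _ _ _ _ _ p q => LK_size p + LK_size q
  end.

Fixpoint LK_cut_free (S : sequent fform) (p : LK S) : bool :=
  match p with
  | LK_ax _ => true
  | LK_exch _ _ _ _ _ _ p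
  | LK_wl _ _ _ p | LK_wr _ _ _ p | LK_cl _ _ _ p | LK_cr _ _ _ p
  | LK_negl _ _ _ p | LK_negr _ _ _ p
  | LK_andl1 _ _ _ _ p | LK_andl2 _ _ _ _ p
  | LK_orr1 _ _ _ _ p | LK_orr2 _ _ _ _ p | LK_impr _ _ _ _ p
  | LK_alll _ _ _ _ p | LK_allr _ _ _ p
  | LK_exl _ _ _ p | LK_exr _ _ _ _ p => LK_cut_free p
  | LK_cut _ _ _ _ _ _ _ => false
  | LK_andr _ _ _ _ _ _ p q
  | LK_orl _ _ _ _ _ _ p q
  | LK_impl _ _ _ _ _ _ p q => LK_cut_free p && LK_cut_free q
  end.

Inductive Leps : sequent eform -> Type :=
| Leps_ax p ts : Leps ([:: EAtom p ts], [:: EAtom p ts])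
| Leps_exch G G' D D' :
    Permutation G G' -> Permutation D D' -> Leps (G, D) -> Leps (G', D')
| Leps_wl A G D : Leps (G, D) -> Leps (A :: G, D)
| Leps_wr A G D : Leps (G, D) -> Leps (G, A :: D)
| Leps_cl A G D : Leps (A :: A :: G, D) -> Leps (A :: G, D)
| Leps_cr A G D : Leps (G, A :: A :: D) -> Leps (G, A :: D)
| Leps_cut A G D P L :
    Leps (G, A :: D) -> Leps (A :: P, L) -> Leps (G ++ P, D ++ L)
| Leps_negl A G D : Leps (G, A :: D) -> Leps (ENeg A :: G, D)
| Leps_negr A G D : Leps (A :: G, D) -> Leps (G, ENeg A :: D)
| Leps_andl1 A B G D : Leps (A :: G, D) -> Leps (EAnd A B :: G, D)
| Leps_andl2 A B G D : Leps (B :: G, D) -> Leps (EAnd A B :: G, D)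
| Leps_andr A B G D P L :
    Leps (G, A :: D) -> Leps (P, B :: L) -> Leps (G ++ P, EAnd A B :: D ++ L)
| Leps_orl A B G D P L :
    Leps (A :: G, D) -> Leps (B :: P, L) -> Leps (EOr A B :: G ++ P, D ++ L)
| Leps_orr1 A B G D : Leps (G, A :: D) -> Leps (G, EOr A B :: D)
| Leps_orr2 A B G D : Leps (G, B :: D) -> Leps (G, EOr A B :: D)
| Leps_impl A B G D P L :
    Leps (G, A :: D) -> Leps (B :: P, L) -> Leps (EImp A B :: G ++ P, D ++ L)
| Leps_impr A B G D : Leps (A :: G, B :: D) -> Leps (G, EImp A B :: D)
| Leps_alll A t G D :
    Leps (einst A t :: G, D) -> Leps (einst A (Eps (ENeg A)) :: G, D)
| Leps_exr A t G D :
    Leps (G, einst A t :: D) -> Leps (G, einst A (Eps A) :: D).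

Fixpoint Leps_size (S : sequent eform) (p : Leps S) : nat :=
  sequent_size eform_size S +
  match p with
  | Leps_ax _ _ => 0
  | Leps_exch _ _ _ _ _ _ p
  | Leps_wl _ _ _ p | Leps_wr _ _ _ p | Leps_cl _ _ _ p | Leps_cr _ _ _ p
  | Leps_negl _ _ _ p | Leps_negr _ _ _ p
  | Leps_andl1 _ _ _ _ p | Leps_andl2 _ _ _ _ p
  | Leps_orr1 _ _ _ _ p | Leps_orr2 _ _ _ _ p | Leps_impr _ _ _ _ p
  | Leps_alll _ _ _ _ p | Leps_exr _ _ _ _ p => Leps_size p
  | Leps_cut _ _ _ _ _ p q
  | Leps_andr _ _ _ _ _ _ p q
  | Leps_orl _ _ _ _ _ _ p q
  | Leps_impl _ _ _ _ _ _ p q => Leps_size p + Leps_size q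
  end.

Fixpoint Leps_cut_free (S : sequent eform) (p : Leps S) : bool :=
  match p with
  | Leps_ax _ _ => true
  | Leps_exch _ _ _ _ _ _ p
  | Leps_wl _ _ _ p | Leps_wr _ _ _ p | Leps_cl _ _ _ p | Leps_cr _ _ _ p
  | Leps_negl _ _ _ p | Leps_negr _ _ _ p
  | Leps_andl1 _ _ _ _ p | Leps_andl2 _ _ _ _ p
  | Leps_orr1 _ _ _ _ p | Leps_orr2 _ _ _ _ p | Leps_impr _ _ _ _ p
  | Leps_alll _ _ _ _ p | Leps_exr _ _ _ _ p => Leps_cut_free p
  | Leps_cut _ _ _ _ _ _ _ => false
  | Leps_andr _ _ _ _ _ _ p q
  | Leps_orl _ _ _ _ _ _ p q
  | Leps_impl _ _ _ _ _ _ p q => Leps_cut_free p && Leps_cut_free q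
  end.

Definition min_cut_free_LK_size (S : sequent fform) (m : nat) : Prop :=
  (exists2 p : LK S, LK_cut_free p & LK_size p = m) /\
  (forall p : LK S, LK_cut_free p -> m <= LK_size p).

Definition poly_bounded (g : nat -> nat) : Prop :=
  exists q : {poly nat}, forall i, g i <= q.[i]%R.

Inductive aterm : Type :=
| AVar (n : nat)
| AZero
| AOne
| AAdd (t u : aterm)
| AMul (t u : aterm)
| AExp2 (t : aterm).

Inductive qf : Type :=
| QEq (t u : aterm)
| QLt (t u : aterm)
| QNot (P : qf)
| QAnd (P Q : qf)
| QOr (P Q : qf)
| QImp (P Q : qf).

Fixpoint aeval (e : seq nat) (t : aterm) : nat :=
  match t with
  | AVar n => nth 0 e n
  | AZero => 0
  | AOne => 1
  | AAdd t u => aeval e t + aeval e u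
  | AMul t u => aeval e t * aeval e u
  | AExp2 t => 2 ^ aeval e t
  end.

Fixpoint qf_eval (e : seq nat) (P : qf) : bool :=
  match P with
  | QEq t u => aeval e t == aeval e u
  | QLt t u => aeval e t < aeval e u
  | QNot P => ~~ qf_eval e P
  | QAnd P Q => qf_eval e P && qf_eval e Q
  | QOr P Q => qf_eval e P || qf_eval e Q
  | QImp P Q => qf_eval e P ==> qf_eval e Q
  end.

(** The graph of f is defined by P, variables 0 and 1 standing for the
    argument and the value. *)
Definition elementary (f : nat -> nat) : Prop :=
  exists P : qf, forall x y : nat, f x = y <-> qf_eval [:: x; y] P.

(* Main.v *)
Require Import Defs.
From mathcomp Require Import all_boot ssralg poly zify.
From Stdlib Require Import Permutation ClassicalEpsilon FunctionalExtensionality.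

Set Implicit Arguments.
Unset Strict Implicit.
Unset Printing Implicit Defensive.

(** The end-sequents are Orevkov's: Horn axioms for the relation x + 2^w = z
    together with marks q_n(0), q_(i+1)(w) /\ w' = 2^w -> q_i(w'), ~ q_0(z), so that
    refuting them amounts to computing a tower of n exponentials.  To these are
    added tautologies of the form forall xs (F -> F), with F quantifier-free.

    The short first-order refutation cuts on A_i(w), where A_(i+1)(w) is
    forall x (A_i(x) -> exists z (A_i(z) /\ x + 2^w = z)).  In the epsilon
    language A_i(w) is quantifier-free, hence an instance of one of the F, so
    each cut becomes an instance of a weakly quantified tautology, and a
    propositional argument from linearly many critical formulas yields a
    cut-free proof of size elementary in n.

    In a cut-free LK-proof of size K only terms of value at most K can be used
    as witnesses, and the axioms are all true in the natural numbers when
    quantifiers range over 0, ..., K with K below the tower; thus size is at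
    least the tower.  Polynomial bounds are reached by letting n depend on i and
    grow as slowly as an iterated logarithm of fixed depth.

    Finally, a function with a quantifier-free graph is bounded by an iterated
    exponential of fixed depth: for fixed x, terms in y have Cantor normal forms
    with coefficients and exponents elementary in x, so that for y large all
    comparisons between terms no longer depend on y. *)

(** * Functions with quantifier-free graph *)

Definition exps (k x : nat) : nat := iter k (expn 2) x.

Lemma exps_add k l x : exps (k + l) x = exps k (exps l x).
Proof. exact: iterD. Qed.

Lemma leq_exp2n x : x <= 2 ^ x.
Proof. exact/ltnW/ltn_expl. Qed.

Lemma leq_exps k x y : x <= y -> exps k x <= exps k y.
Proof. by move=> le_xy; elim: k => //= k IH; rewrite leq_exp2l. Qed.

Lemma exps_ge k x : x <= exps k x.
Proof. by elim: k => //= k IH; apply: leq_trans IH (leq_exp2n _). Qed.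

Lemma leq_expsl k l x : k <= l -> exps k x <= exps l x.
Proof. by move=> /subnK <-; rewrite exps_add exps_ge. Qed.

Lemma sqr_le_exps2 z : z * z < exps 2 z.
Proof.
have [z_gt3|] := ltnP 3 z; last by case: z => [|[|[|[|]]]].
apply: (@leq_ltn_trans (2 ^ z)); last exact: ltn_expl.
elim: z z_gt3 => // z IH; rewrite leq_eqVlt => /predU1P[[<-] //|z_gt3].
by have := IH z_gt3; rewrite expnS; move: z_gt3; clear; move: (2 ^ z) => t; nia.
Qed.

(* [NC e p c r] stands for c * y^p * 2^e + r, a Cantor normal form in y. *)
Inductive nf := NZ | NC (e : nf) (p c : nat) (r : nf).

Fixpoint nf_val (y : nat) (a : nf) : nat :=
  if a is NC e p c r then c * (y ^ p * 2 ^ nf_val y e) + nf_val y r else 0.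

(** One number bounding nesting depth, length, powers and coefficients at once. Sums add it and
    products multiply it, so it stays elementary in the coefficients. *)
Fixpoint nf_norm (a : nf) : nat :=
  if a is NC e p c r then (nf_norm e + p + c + nf_norm r).+1 else 0.

Definition lexc (c d : comparison) : comparison := if c is Eq then d else c.

Definition ncmp (m n : nat) : comparison :=
  if m < n then Lt else if m == n then Eq else Gt.

(** The order of growth: the exponent of 2 decides first, then the power of y, then the coefficient,
    then the remaining monomials. *)
Fixpoint nf_cmp (a b : nf) : comparison :=
  match a, b with
  | NZ, NZ => Eq
  | NZ, NC _ _ _ _ => Lt
  | NC _ _ _ _, NZ => Gt
  | NC e p c r, NC e' p' c' r' =>
      lexc (nf_cmp e e') (lexc (ncmp p p') (lexc (ncmp c c') (nf_cmp r r')))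
  end.

Definition mon_cmp (e : nf) (p : nat) (e' : nf) (p' : nat) : comparison :=
  lexc (nf_cmp e e') (ncmp p p').

Definition head_lt (a : nf) (e : nf) (p : nat) : Prop :=
  if a is NC e' p' _ _ then mon_cmp e' p' e p = Lt else True.

(* Constant factors of 2^e are kept in the coefficient, so exponents have no
   constant term. *)
Fixpoint nf_noconst (a : nf) : Prop :=
  if a is NC e p _ r then (e <> NZ \/ 0 < p) /\ nf_noconst r else True.

Fixpoint nf_wf (a : nf) : Prop :=
  if a is NC e p c r then
    [/\ nf_wf e, nf_noconst e, 0 < c, nf_wf r & head_lt r e p]
  else True.

Lemma ncmpP m n : match ncmp m n with Lt => m < n | Eq => m = n | Gt => n < m end.
Proof. by rewrite /ncmp; case: ltngtP. Qed.

Lemma nf_cmp_eq a b : nf_cmp a b = Eq -> a = b.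
Proof.
elim: a b => [|e IHe p c r IHr] [|e' p' c' r'] //=.
case He: nf_cmp => //=; have := ncmpP p p'; case: ncmp => //= ->.
by have := ncmpP c c'; case: ncmp => //= -> /IHr ->; rewrite (IHe _ He).
Qed.

Lemma nf_cmp_gt a b : nf_cmp a b = Gt -> nf_cmp b a = Lt.
Proof.
elim: a b => [|e IHe p c r IHr] [|e' p' c' r'] //=.
case He: nf_cmp => //=; last by rewrite IHe.
rewrite (nf_cmp_eq He); have -> : nf_cmp e' e' = Eq.
  by elim: (e') => //= ? -> ? ? ? ->; rewrite /ncmp !ltnn !eqxx.
rewrite /ncmp; case: (ltngtP p p') => //= _; case: (ltngtP c c') => //= _.
exact: IHr.
Qed.

Lemma mon_cmp_eq e p e' p' : mon_cmp e p e' p' = Eq -> e = e' /\ p = p'.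
Proof.
rewrite /mon_cmp; case He: nf_cmp => //=; have := ncmpP p p'; case: ncmp => //= ->.
by rewrite (nf_cmp_eq He).
Qed.

Lemma mon_cmp_gt e p e' p' : mon_cmp e p e' p' = Gt -> mon_cmp e' p' e p = Lt.
Proof.
rewrite /mon_cmp; case He: nf_cmp => //=; last by rewrite nf_cmp_gt.
rewrite (nf_cmp_eq He); have -> : nf_cmp e' e' = Eq.
  by elim: (e') => //= ? -> ? ? ? ->; rewrite /ncmp !ltnn !eqxx.
by rewrite /ncmp; case: (ltngtP p p').
Qed.

Fixpoint nf_insert (e : nf) (p c : nat) (b : nf) : nf :=
  if b is NC e' p' c' r then
    match mon_cmp e p e' p' with
    | Gt => NC e p c b
    | Eq => NC e' p' (c + c') r
    | Lt => NC e' p' c' (nf_insert e p c r)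
    end
  else NC e p c NZ.

Lemma nf_insert_val y e p c b :
  nf_val y (nf_insert e p c b) = c * (y ^ p * 2 ^ nf_val y e) + nf_val y b.
Proof.
elim: b => //= e' _ p' c' r IH; case Hm: mon_cmp => //=.
  by have [-> ->] := mon_cmp_eq Hm; rewrite mulnDl addnA.
by rewrite IH addnCA.
Qed.

Lemma nf_insert_norm e p c b :
  nf_norm (nf_insert e p c b) <= (nf_norm e + p + c + nf_norm b).+1.
Proof. by elim: b => /= [|e' _ p' c' r IH]; last case: mon_cmp => /=; lia. Qed.

Lemma nf_insert_noconst e p c b :
  e <> NZ \/ 0 < p -> nf_noconst b -> nf_noconst (nf_insert e p c b).
Proof.
move=> nc; elim: b => //= e' _ p' c' r IH [nc' ncr].
by case Hm: mon_cmp => //=; split=> //; apply: IH.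
Qed.

Lemma nf_insert_wf e p c b :
  nf_wf e -> nf_noconst e -> 0 < c -> nf_wf b -> nf_wf (nf_insert e p c b).
Proof.
move=> we nce c0; elim: b => //= e' _ p' c' r IH [we' nce' c0' wr hr].
case Hm: mon_cmp => /=; split=> //; first by rewrite addn_gt0 c0.
- exact: IH.
- by case: r {IH} hr wr => //= e1 p1 c1 r1 ? _; case: (mon_cmp e p e1 p1).
- exact: mon_cmp_gt.
Qed.

Definition represents (a : nf) (t : nat -> nat) : Prop :=
  nf_wf a /\ forall y, nf_val y a = t y.

Lemma represents_add a b t u :
    represents a t -> represents b u ->
  exists c, [/\ represents c (fun y => t y + u y),
    nf_norm c <= nf_norm a + nf_norm b &
    nf_noconst a -> nf_noconst b -> nf_noconst c].
Proof.
elim: a t => [|e _ p c r IH] t [/= wa va] rb.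
  by exists b; split=> //; case: rb => wb vb; split=> // y; rewrite -va vb.
case: wa => we nce c0 wr _; have [|d [[wd vd] nd ncd]] := IH (nf_val^~ r) _ rb.
  by [].
exists (nf_insert e p c d); split; last 1 first.
- by case=> nc ncr ncb; apply: nf_insert_noconst => //; apply: ncd.
- by split=> [|y]; [apply: nf_insert_wf | rewrite nf_insert_val vd -va addnA].
- by apply: leq_trans (nf_insert_norm _ _ _ _) _; rewrite /=; lia.
Qed.

Lemma represents_mul_mon e p c b u :
    nf_wf e -> nf_noconst e -> 0 < c -> represents b u ->
  exists d, represents d (fun y => c * (y ^ p * 2 ^ nf_val y e) * u y) /\
    nf_norm d <= (nf_norm e + p + c).+1 * nf_norm b.
Proof.
move=> we nce c0; elim: b u => [|e' _ p' c' r IH] u [/= wb vb].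
  by exists NZ; split; [split=> // y; rewrite -vb muln0 | rewrite muln0].
case: wb => we' nce' c0' wr _; have [|d [rd nd]] := IH (nf_val^~ r); first by [].
have [f [[wf vf] nnf ncf]] := @represents_add e e' (nf_val^~ e) (nf_val^~ e')
  (conj we (fun=> erefl)) (conj we' (fun=> erefl)).
have [|g [[wg vg] ng _]] := @represents_add (NC f (p + p') (c * c') NZ) d
  (nf_val^~ (NC f (p + p') (c * c') NZ)) _ _ rd.
  by split=> //=; split=> //; [apply: ncf | rewrite muln_gt0 c0].
exists g; split; last by move: ng => /=; nia.
split=> // y; rewrite vg -vb /= vf !expnD addn0 mulnDr; congr (_ + _).
by rewrite -!mulnA; congr (_ * _); rewrite mulnCA; do 3!rewrite [RHS]mulnCA; lia.
Qed.

Lemma represents_mul a b t u :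
    represents a t -> represents b u ->
  exists d, represents d (fun y => t y * u y) /\ nf_norm d <= nf_norm a * nf_norm b.
Proof.
elim: a t => [|e _ p c r IH] t [/= wa va] rb.
  by exists NZ; split=> //; split=> // y; rewrite -va.
case: wa => we nce c0 wr _; have [|d [rd nd]] := IH (nf_val^~ r) _ rb; first by [].
have [f [rf nnf]] := represents_mul_mon p we nce c0 rb.
have [g [[wg vg] ng _]] := represents_add rf rd.
exists g; split; last by move: ng => /=; nia.
by split=> // y; rewrite vg -va mulnDl.
Qed.

(** The constant term has to leave a normal form before that form may serve as an exponent:
    [2 ^ (b + k)] is [2 ^ k * 2 ^ b], and [2 ^ k] becomes a coefficient. *)
Lemma represents_split a :
    nf_wf a ->
  exists b k, [/\ nf_wf b, nf_noconst b, nf_norm b + k <= nf_norm a &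
    forall y, nf_val y a = nf_val y b + k].
Proof.
elim: a => [|e _ p c r IH] /=; first by exists NZ, 0.
case=> we nce c0 /IH[b [k [wb ncb nb vb]]] _.
have [[-> ->]|nc] : (e = NZ /\ p = 0) \/ (e <> NZ \/ 0 < p).
- by case: p => [|p]; [case: (e); [left|right; left] | right; right].
- exists b, (c + k); split=> //= [|y]; first by lia.
  by rewrite vb expn0 !muln1; lia.
exists (nf_insert e p c b), k; split.
- exact: nf_insert_wf.
- exact: nf_insert_noconst.
- by have := nf_insert_norm e p c b; lia.
- by move=> y; rewrite nf_insert_val vb addnA.
Qed.

Lemma represents_exp a t :
    represents a t ->
  exists d, represents d (fun y => 2 ^ t y) /\ nf_norm d <= 2 ^ (nf_norm a + 2).
Proof.
case=> wa va; have [b [k [wb ncb nb vb]]] := represents_split wa.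
exists (NC b 0 (2 ^ k) NZ); split; first split=> /=.
- by split=> //; rewrite expn_gt0.
- by move=> y; rewrite -va vb expn0 mul1n -expnD addn0 addnC.
rewrite /= addn0; have ltb := ltn_expl (nf_norm b) (ltnSn 1).
have : 2 ^ k <= 2 ^ nf_norm a by rewrite leq_exp2l //; lia.
have : 2 ^ nf_norm b <= 2 ^ nf_norm a by rewrite leq_exp2l //; lia.
by rewrite expnD; move: ltb; lia.
Qed.

Lemma exps2_add2 z : z + 2 <= exps 2 z.
Proof.
rewrite /exps /=; elim: z => // z IH; apply: (@leq_ltn_trans (2 ^ (2 ^ z))).
  exact: IH.
by rewrite ltn_exp2l // ltn_exp2l.
Qed.

(** The height [k] depends on the term alone; only the normal form varies with [x], which enters
    through coefficients and constants in exponents. *)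
Lemma aterm_represents t :
  exists k, forall x, exists a,
    represents a (fun y => aeval [:: x; y] t) /\ nf_norm a <= exps k x.
Proof.
have const c : exists a, represents a (fun=> c) /\ nf_norm a <= c.+1.
  case: c => [|c]; first by exists NZ.
  by exists (NC NZ 0 c.+1 NZ); split; [split=> // y /=; rewrite expn0; lia | rewrite /=; lia].
have two k l x : exps k x <= exps (k + l) x /\ exps l x <= exps (k + l) x.
  by split; apply: leq_expsl; lia.
elim: t => [[|[|n]]|||t [k IHt] u [l IHu]|t [k IHt] u [l IHu]|t [k IHt]].
- exists 1 => x; have [a [ra na]] := const x; exists a; split=> //.
  exact: leq_trans na (ltn_expl _ _).
- exists 3 => x; exists (NC NZ 1 1 NZ); split; first by split=> // y /=; rewrite expn1; lia.
  by apply: leq_trans (leq_exps 3 (leq0n x)).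
(* Only variables 0 and 1 have entries in the environment; all others take the default value 0. *)
- exists 1 => x; exists NZ; split=> //; split=> // y /=.
  by rewrite nth_nil.
- by exists 1 => x; exists NZ.
- exists 3 => x; have [a [ra na]] := const 1; exists a; split=> //.
  exact: leq_trans na (leq_trans _ (leq_exps 3 (leq0n x))).
- exists (2 + (k + l)) => x; have [a [ra na]] := IHt x; have [b [rb nb]] := IHu x.
  have [c [rc nc _]] := represents_add ra rb; exists c; split=> //.
  rewrite exps_add; have [] := two k l x; have := sqr_le_exps2 (exps (k + l) x).
  have := exps2_add2 (exps (k + l) x); move: (exps (k + l) x) => z; move: (exps 2 z) => w.
  by case: z => [|[|z]]; nia.
- exists (2 + (k + l)) => x; have [a [ra na]] := IHt x; have [b [rb nb]] := IHu x.
  have [c [rc nc]] := represents_mul ra rb; exists c; split=> //.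
  rewrite exps_add; have [] := two k l x; have := sqr_le_exps2 (exps (k + l) x).
  by nia.
- exists (3 + k) => x; have [a [ra na]] := IHt x.
  have [c [rc nc]] := represents_exp ra; exists c; split=> //.
  apply: leq_trans nc _; rewrite exps_add /= leq_exp2l //.
  by move: na (exps2_add2 (exps k x)); rewrite /exps /=; lia.
Qed.

(** * Comparison of normal forms at large arguments *)

Section Comparison.

(** [N] bounds the norms involved. By [y_gt], y exceeds twice any sum of coefficients; by [y_pow], a
    factor [2 ^ y] beats the square of every [y ^ p.+1] with [p <= N]. *)
Variables y N : nat.
Hypotheses (y_gt : 2 * N < y) (y_pow : y ^ (2 * N + 2) <= 2 ^ y).

Definition mon_val (e : nf) (p : nat) : nat := y ^ p * 2 ^ nf_val y e.

Lemma mon_val_gt0 e p : 0 < mon_val e p.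
Proof. by rewrite muln_gt0 !expn_gt0; lia. Qed.

Lemma nf_val_ge a : nf_wf a -> nf_noconst a -> a <> NZ -> y <= nf_val y a.
Proof.
suff mon e p : (e <> NZ -> y <= nf_val y e) -> e <> NZ \/ 0 < p -> y <= mon_val e p.
  elim: a => [|e IHe p c r _] //= [we nce c0 _ _] [nc _] _.
  apply: leq_trans (mon e p (IHe we nce) nc) _.
  exact: leq_trans (leq_pmull _ c0) (leq_addr _ _).
rewrite /mon_val => ge_e; case: p => [|p] nc.
  rewrite expn0 mul1n; case: nc => // /ge_e le_ye.
  exact: leq_trans le_ye (leq_exp2n _).
by rewrite expnS -mulnA leq_pmulr // muln_gt0 !expn_gt0; lia.
Qed.

Lemma mon_val_ge e p :
  nf_wf e -> nf_noconst e -> e <> NZ \/ 0 < p -> y <= mon_val e p.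
Proof.
move=> we nce nc; have := @nf_val_ge (NC e p 1 NZ); rewrite /= mul1n addn0.
by apply.
Qed.

(** The second clause strengthens the induction: forms without constant terms differ by at least
    y/2, so that as exponents of 2 they differ by a factor that no relevant power of y can
    offset. *)
Definition cmp_correct (a b : nf) : Prop :=
  nf_wf a -> nf_wf b -> nf_cmp a b = Lt ->
  nf_val y a < nf_val y b /\
  (nf_noconst a -> nf_noconst b -> 2 * nf_val y a + y <= 2 * nf_val y b).

(** With equal exponents a larger power of y supplies the factor y. With different exponents the gap
    y/2 supplies [2 ^ (y/2)], which beats [y ^ p.+1] by [y_pow]; squaring both sides avoids the
    half. *)
Lemma mon_gap e p e' p' :
    nf_wf e -> nf_noconst e -> nf_wf e' -> nf_noconst e' -> p <= N ->
    cmp_correct e e' -> mon_cmp e p e' p' = Lt ->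
  y * mon_val e p <= mon_val e' p'.
Proof.
move=> we nce we' nce' le_pN ce; rewrite /mon_cmp; case He: nf_cmp => //=.
  rewrite (nf_cmp_eq He); have := ncmpP p p'; case: ncmp => // lt_p _.
  rewrite /mon_val mulnA -expnS leq_mul2r leq_pexp2l ?orbT //; lia.
move=> _; have [_ /(_ nce nce') gap] := ce we we' He.
rewrite -leq_sqr /mon_val mulnA -expnS.
apply: (@leq_trans (2 ^ (2 * nf_val y e'))).
  rewrite expnMn -!expnM; apply: leq_trans (_ : 2 ^ y * 2 ^ (nf_val y e * 2) <= _).
    rewrite leq_mul2r; apply/orP; right; apply: leq_trans y_pow.
    by rewrite leq_pexp2l; lia.
  by rewrite -expnD leq_exp2l; lia.
rewrite mulnC expnM -[X in X <= _]mul1n expnMn leq_mul2r; apply/orP; right.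
by rewrite !expn_gt0; lia.
Qed.

(** Each monomial of [r] is smaller than the head by a factor y, and the coefficients add up to at
    most the norm. As y exceeds twice the norm, a tail stays below half the head. *)
Lemma tail_gap r e p :
    nf_wf r -> nf_wf e -> nf_noconst e -> nf_norm r <= N ->
    (forall e', nf_norm e' < nf_norm r -> cmp_correct e' e) ->
    (forall e' e'', nf_norm e' + nf_norm e'' < nf_norm r -> cmp_correct e' e'') ->
    head_lt r e p ->
  y * nf_val y r <= nf_norm r * mon_val e p.
Proof.
elim: r e p => [|e1 _ p1 c1 r1 IH] e p; first by rewrite muln0.
move=> [we1 nce1 _ wr1 hr1] we nce le_N ce ce' hd.
have /= le_r1 : y * nf_val y r1 <= nf_norm r1 * mon_val e1 p1.
  apply: IH => //; first by move: le_N => /=; lia.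
  - by move=> e' lt_e'; apply: ce' => /=; lia.
  - by move=> e' e'' lt_e'; apply: ce' => /=; lia.
have /= gap : y * mon_val e1 p1 <= mon_val e p.
  apply: mon_gap => //; first by move: le_N => /=; lia.
  by apply: ce => /=; lia.
have y0 : 0 < y by lia.
rewrite /= -/(mon_val e1 p1); move: (mon_val e1 p1) (mon_val e p) le_r1 gap.
move=> m1 m le_r1 gap; have : m1 <= m by nia.
by nia.
Qed.

(** Induction on the sum of the norms. If the heads agree, the tails are compared; if only the
    coefficients differ, the spare monomial outweighs the tail; if the head of [a] is smaller, all
    of [a] behaves like a tail under the head of [b]. *)
Lemma nf_cmp_correct a b : nf_norm a + nf_norm b <= N -> cmp_correct a b.
Proof.
have [k] := ubnP (nf_norm a + nf_norm b).
elim: k a b => // k IH a b lt_k le_N wa wb.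
case: b wb lt_k le_N => [|e' p' c' r']; first by case: (a).
move=> [we' nce' c0' wr' hr'] /= lt_k le_N lt_ab; rewrite -/(mon_val e' p').
have tail r : nf_wf r -> nf_norm r <= nf_norm a -> head_lt r e' p' ->
    2 * nf_val y r <= mon_val e' p'.
  move=> wr le_r hr; have : y * nf_val y r <= nf_norm r * mon_val e' p'.
    apply: tail_gap => //; first by lia.
    - by move=> e1 lt_e1; apply: IH; lia.
    - by move=> e1 e2 lt_e1; apply: IH; lia.
  move: (mon_val _ _) (mon_val_gt0 e' p') => m m0.
  by move: (nf_val y r) le_r; nia.
have m0 := mon_val_gt0 e' p'.
have my := @mon_val_ge e' p' we' nce'.
have small : 2 * nf_val y a <= mon_val e' p' ->
    nf_val y a < c' * mon_val e' p' + nf_val y r' /\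
    (nf_noconst a -> (e' <> NZ \/ 0 < p') /\ nf_noconst r' ->
     2 * nf_val y a + y <= 2 * (c' * mon_val e' p' + nf_val y r')).
  move: (mon_val e' p') m0 my => m m0 my le_m; have : m <= c' * m by rewrite leq_pmull.
  by move=> le_cm; split=> [|_ [/my le_ym _]]; lia.
case: a wa lt_k le_N lt_ab tail small => [|e p c r]; first by move=> _ _ _ _ _; apply.
move=> wa lt_k le_N lt_ab tail small.
case Hm: (mon_cmp e p e' p').
- have [def_e def_p] := mon_cmp_eq Hm; subst e' p'.
  move: lt_ab => /=; have -> : nf_cmp e e = Eq.
    by elim: (e) => //= ? -> ? ? ? ->; rewrite /ncmp !ltnn !eqxx.
  case: wa => we nce c0 wr hr.
  rewrite {1}/ncmp ltnn eqxx /=; have := ncmpP c c'; case: ncmp => //= [<- lt_r|lt_c _].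
    have [] := IH r r'; rewrite /= in lt_k le_N; try lia; try done.
    move=> lt_v gap; split=> [|[_ ncr] [_ ncr']]; first by rewrite ltn_add2l.
    by have := gap ncr ncr'; rewrite /mon_val; lia.
  have le_r : 2 * nf_val y r <= mon_val e p by apply: tail => //=; lia.
  have : c * mon_val e p + mon_val e p <= c' * mon_val e p.
    by rewrite -mulSnr leq_mul2r lt_c orbT.
  rewrite -/(mon_val e p); split=> [|_ [/my le_ym _]]; move: m0; lia.
- exact/small/tail.
- by move: lt_ab Hm; rewrite /= /mon_cmp; case: nf_cmp => //=; case: ncmp.
Qed.

End Comparison.

Lemma sqrS_le_exp2 z : 6 <= z -> z.+1 * z.+1 <= 2 ^ z.
Proof.
elim: z => // z IH; rewrite leq_eqVlt => /predU1P[[<-] //|lt_z].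
by have := IH lt_z; rewrite expnS; move: (2 ^ z) => w; nia.
Qed.

(** With L the integer part of the binary logarithm of y, the power is at most 2 to the (L+1)(2N+2),
    and this exponent is at most the square of L+1, hence at most [2 ^ L <= y]. *)
Lemma pow_threshold N y : exps 5 N <= y -> 2 * N < y /\ y ^ (2 * N + 2) <= 2 ^ y.
Proof.
move=> le_y; have y0 : 0 < y by apply: leq_trans le_y; rewrite expn_gt0.
have /andP[le_L lt_L] := trunc_log_bounds (ltnSn 1) y0.
set L := trunc_log 2 y in le_L lt_L.
have ge_L : exps 4 N <= L by apply: trunc_log_max.
have le_N : 2 * N + 4 <= exps 3 N.
  apply: (@leq_trans (2 ^ (2 ^ N).+1)).
    rewrite expnS; have := ltn_expl N (ltnSn 1); have := ltn_expl (2 ^ N) (ltnSn 1).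
    by move: (2 ^ (2 ^ N)); lia.
  by rewrite /exps /= leq_exp2l // ltn_expl.
have ge16 : 16 <= exps 4 N by apply: leq_trans (leq_exps 4 (leq0n N)).
have le_34 : exps 3 N <= exps 4 N by apply: leq_expsl.
have le_sq : L.+1 * L.+1 <= 2 ^ L by apply: sqrS_le_exp2; lia.
split; first by have := leq_exp2n L; lia.
apply: leq_trans (_ : (2 ^ L.+1) ^ (2 * N + 2) <= _).
  by rewrite leq_exp2r ?(ltnW lt_L) //; lia.
by rewrite -expnM leq_exp2l //; nia.
Qed.

Lemma qf_eventually P :
  exists k, forall x, exists b, forall y, exps k x <= y -> qf_eval [:: x; y] P = b.
Proof.
have cmp t u : exists k, forall x, exists c, forall y, exps k x <= y ->
    match c with
    | Lt => aeval [:: x; y] t < aeval [:: x; y] u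
    | Eq => aeval [:: x; y] t = aeval [:: x; y] u
    | Gt => aeval [:: x; y] u < aeval [:: x; y] t
    end.
  have [k kt] := aterm_represents t; have [l lu] := aterm_represents u.
  (* Two exponentials absorb the sum of the two norms, five more come from [pow_threshold]. *)
  exists (5 + (2 + (k + l))) => x; have [a [[wa va] na]] := kt x; have [b [[wb vb] nb]] := lu x.
  exists (nf_cmp a b) => y; rewrite (exps_add 5) (exps_add 2) => le_y.
  have le_N : nf_norm a + nf_norm b <= exps 2 (exps (k + l) x).
    have := leq_expsl x (leq_addr l k); have := leq_expsl x (leq_addl k l).
    have := exps2_add2 (exps (k + l) x); have := sqr_le_exps2 (exps (k + l) x).
    by move: (exps (k + l) x) => z; move: (exps 2 z) => w; case: z => [|[|z]]; nia.
  have [y_gt y_pow] := pow_threshold le_y; rewrite -va -vb.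
  case Hc: nf_cmp; first by rewrite (nf_cmp_eq Hc).
  - by have [] := nf_cmp_correct y_gt y_pow le_N wa wb Hc.
  - by rewrite addnC in le_N; have [] := nf_cmp_correct y_gt y_pow le_N wb wa (nf_cmp_gt Hc).
have two k l x y : exps (k + l) x <= y -> exps k x <= y /\ exps l x <= y.
  by move=> le_y; split; apply: leq_trans le_y; apply: leq_expsl; lia.
elim: P => [t u|t u|P [k IHP]|P [k IHP] Q [l IHQ]|P [k IHP] Q [l IHQ]|P [k IHP] Q [l IHQ]].
- have [k kP] := cmp t u; exists k => x; have [c cP] := kP x.
  exists (if c is Eq then true else false) => y /cP /=.
  by case: c {cP} => [->|/ltn_eqF|/gtn_eqF] //; rewrite eqxx.
- have [k kP] := cmp t u; exists k => x; have [c cP] := kP x.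
  exists (if c is Lt then true else false) => y /cP /=.
  by case: c {cP} => [->||/ltnW] //; rewrite ?ltnn // ltnNge => ->.
- by exists k => x; have [b bP] := IHP x; exists (~~ b) => y /bP /= ->.
- exists (k + l) => x; have [b bP] := IHP x; have [c cP] := IHQ x.
  by exists (b && c) => y /two[/bP Pb /cP Qc] /=; rewrite Pb Qc.
- exists (k + l) => x; have [b bP] := IHP x; have [c cP] := IHQ x.
  by exists (b || c) => y /two[/bP Pb /cP Qc] /=; rewrite Pb Qc.
- exists (k + l) => x; have [b bP] := IHP x; have [c cP] := IHQ x.
  by exists (b ==> c) => y /two[/bP Pb /cP Qc] /=; rewrite Pb Qc.
Qed.

(** If [f x] reached the threshold beyond which the formula no longer depends on y, then [(f x).+1]
    would satisfy it as well, and the graph would have two values at [x]. *)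
Lemma elementary_bound f : elementary f -> exists k, forall x, f x < exps k x.
Proof.
case=> P fP; have [k kP] := qf_eventually P; exists k => x.
have [b bP] := kP x; rewrite ltnNge; apply/negP => le_f.
have Pf : b by rewrite -(bP _ le_f); apply/fP.
have /fP : qf_eval [:: x; (f x).+1] P by rewrite bP // ltnW.
by move/eqP; rewrite ltn_eqF.
Qed.

(** * Substitution in the epsilon language *)

Fixpoint All_seq (T : Type) (P : T -> Prop) (s : seq T) : Prop :=
  if s is x :: s' then P x /\ All_seq P s' else True.

Lemma All_seq_eq_map (T U : Type) (f g : T -> U) s :
  All_seq (fun x => f x = g x) s -> map f s = map g s.
Proof. by elim: s => //= x s IH [-> /IH ->]. Qed.

Section EInduction.

Variables (P : eterm -> Prop) (Q : eform -> Prop).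
Hypotheses (PVar : forall n, P (EVar n))
  (PFn : forall f ts, All_seq P ts -> P (EFn f ts))
  (PEps : forall A, Q A -> P (Eps A))
  (QAtom : forall p ts, All_seq P ts -> Q (EAtom p ts))
  (QNeg : forall A, Q A -> Q (ENeg A))
  (QAnd : forall A B, Q A -> Q B -> Q (EAnd A B))
  (QOr : forall A B, Q A -> Q B -> Q (EOr A B))
  (QImp : forall A B, Q A -> Q B -> Q (EImp A B)).

Fixpoint eterm_induction (t : eterm) : P t :=
  let fix all ts : All_seq P ts :=
    match ts with [::] => I | t :: ts => conj (eterm_induction t) (all ts) end in
  match t with
  | EVar n => PVar n
  | EFn f ts => PFn f (all ts)
  | Eps A => PEps (eform_induction A)
  end
with eform_induction (A : eform) : Q A :=
  let fix all ts : All_seq P ts :=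
    match ts with [::] => I | t :: ts => conj (eterm_induction t) (all ts) end in
  match A with
  | EAtom p ts => QAtom p (all ts)
  | ENeg A => QNeg (eform_induction A)
  | EAnd A B => QAnd (eform_induction A) (eform_induction B)
  | EOr A B => QOr (eform_induction A) (eform_induction B)
  | EImp A B => QImp (eform_induction A) (eform_induction B)
  end.

Lemma e_induction : (forall t, P t) /\ (forall A, Q A).
Proof. exact: conj eterm_induction eform_induction. Qed.

End EInduction.

Definition escons (t : eterm) (s : nat -> eterm) (n : nat) : eterm :=
  if n is m.+1 then s m else t.

Lemma eup_ren r : eup (EVar \o r) = EVar \o upren r.
Proof. by apply: functional_extensionality => -[]. Qed.

Lemma eren_subst :
  (forall t r, etren r t = etsubst (EVar \o r) t) /\
  (forall A r, efren r A = efsubst (EVar \o r) A).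
Proof.
apply: e_induction => //= [f ts IH r|A IH r|p ts IH r|A IH r|A B IHA IHB r|A B IHA IHB r|A B IHA IHB r];
  rewrite ?IH ?IHA ?IHB ?eup_ren //; congr (_ _ _); apply: All_seq_eq_map;
  by elim: ts IH => //= t ts IHts [-> /IHts].
Qed.

Lemma eup_upren s r : eup s \o upren r = eup (s \o r).
Proof. by apply: functional_extensionality => -[]. Qed.

Lemma esubst_ren :
  (forall t s r, etsubst s (etren r t) = etsubst (s \o r) t) /\
  (forall A s r, efsubst s (efren r A) = efsubst (s \o r) A).
Proof.
apply: e_induction => //= [f ts IH s r|A IH s r|p ts IH s r|A IH s r|A B IHA IHB s r|A B IHA IHB s r|A B IHA IHB s r];
  rewrite ?IH ?IHA ?IHB ?eup_upren //; congr (_ _ _); rewrite -map_comp; apply: All_seq_eq_map;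
  by elim: ts IH => //= t ts IHts [-> /IHts].
Qed.

Lemma etren_comp r r' t : etren r (etren r' t) = etren (r \o r') t.
Proof. by rewrite [LHS](eren_subst.1) esubst_ren.1 eren_subst.1. Qed.

Lemma eup_etren r s : etren (upren r) \o eup s = eup (etren r \o s).
Proof.
apply: functional_extensionality => -[|m] //=.
by rewrite !etren_comp.
Qed.

Lemma eren_esubst :
  (forall t r s, etren r (etsubst s t) = etsubst (etren r \o s) t) /\
  (forall A r s, efren r (efsubst s A) = efsubst (etren r \o s) A).
Proof.
apply: e_induction => //= [f ts IH r s|A IH r s|p ts IH r s|A IH r s|A B IHA IHB r s|A B IHA IHB r s|A B IHA IHB r s];
  rewrite ?IH ?IHA ?IHB ?eup_etren //; congr (_ _ _); rewrite -map_comp; apply: All_seq_eq_map;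
  by elim: ts IH => //= t ts IHts [-> /IHts].
Qed.

Lemma etsubst_eup_shift s t : etsubst (eup s) (etren succn t) = etren succn (etsubst s t).
Proof. by rewrite esubst_ren.1 eren_esubst.1. Qed.

Lemma eup_comp s s' : etsubst (eup s) \o eup s' = eup (etsubst s \o s').
Proof.
apply: functional_extensionality => -[|m] //=.
exact: etsubst_eup_shift.
Qed.

Lemma esubst_comp :
  (forall t s s', etsubst s (etsubst s' t) = etsubst (etsubst s \o s') t) /\
  (forall A s s', efsubst s (efsubst s' A) = efsubst (etsubst s \o s') A).
Proof.
apply: e_induction => //= [f ts IH r s|A IH r s|p ts IH r s|A IH r s|A B IHA IHB r s|A B IHA IHB r s|A B IHA IHB r s];
  rewrite ?IH ?IHA ?IHB ?eup_comp //; congr (_ _ _); rewrite -map_comp; apply: All_seq_eq_map;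
  by elim: ts IH => //= t ts IHts [-> /IHts].
Qed.

Lemma eup_EVar : eup EVar = EVar.
Proof. by apply: functional_extensionality => -[]. Qed.

Lemma esubst_id :
  (forall t, etsubst EVar t = t) /\ (forall A, efsubst EVar A = A).
Proof.
apply: e_induction => //= [f ts IH|A IH|p ts IH|A ->|A B -> ->|A B -> ->|A B -> ->] //;
  rewrite ?eup_EVar ?IH //; congr (_ _ _); rewrite -[RHS]map_id; exact: All_seq_eq_map.
Qed.

Lemma etsubst_escons_shift t s u : etsubst (escons t s) (etren succn u) = etsubst s u.
Proof. exact: esubst_ren.1. Qed.

Lemma einst_shift t u : etsubst (escons t EVar) (etren succn u) = u.
Proof. by rewrite etsubst_escons_shift esubst_id.1. Qed.

Lemma einstE A t : einst A t = efsubst (escons t EVar) A.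
Proof. by []. Qed.

Lemma efsubst_einst s A t :
  efsubst s (einst A t) = einst (efsubst (eup s) A) (etsubst s t).
Proof.
rewrite !einstE !esubst_comp.2; congr efsubst; apply: functional_extensionality.
by case=> //= n; rewrite einst_shift.
Qed.

Lemma einst_eup s A t : einst (efsubst (eup s) A) t = efsubst (escons t s) A.
Proof.
rewrite einstE esubst_comp.2; congr efsubst; apply: functional_extensionality.
by case=> //= n; rewrite einst_shift.
Qed.

(** * Sizes in the epsilon language *)

Lemma eren_size :
  (forall t r, eterm_size (etren r t) = eterm_size t) /\
  (forall A r, eform_size (efren r A) = eform_size A).
Proof.
apply: e_induction => //= [f ts IH r|A IH r|p ts IH r|A IH r|A B IHA IHB r|A B IHA IHB r|A B IHA IHB r];
  rewrite ?IH ?IHA ?IHB //; rewrite -map_comp; congr (sumn _).+1; apply: All_seq_eq_map;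
  by elim: ts IH => //= t ts IHts [-> /IHts].
Qed.

Lemma esize_gt0 : (forall t, 0 < eterm_size t) /\ (forall A, 0 < eform_size A).
Proof. by apply: e_induction. Qed.

Lemma sumn_map_le (T : Type) (f g : T -> nat) M s :
  All_seq (fun x => f x <= g x * M) s -> sumn (map f s) <= sumn (map g s) * M.
Proof. by elim: s => //= x s IH [? /IH]; rewrite mulnDl; lia. Qed.

Lemma esubst_size :
  (forall t s M, (forall n, eterm_size (s n) <= M) ->
     eterm_size (etsubst s t) <= eterm_size t * M) /\
  (forall A s M, (forall n, eterm_size (s n) <= M) ->
     eform_size (efsubst s A) <= eform_size A * M).
Proof.
have pos (s : nat -> eterm) M : (forall n, eterm_size (s n) <= M) -> 0 < M.
  by move/(_ 0); apply: leq_trans; apply: esize_gt0.1.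
have seq_case ts (s : nat -> eterm) M : (forall n, eterm_size (s n) <= M) ->
    All_seq (fun t => forall s M, (forall n, eterm_size (s n) <= M) ->
      eterm_size (etsubst s t) <= eterm_size t * M) ts ->
    sumn (map eterm_size (map (etsubst s) ts)) < (sumn (map eterm_size ts)).+1 * M.
  move=> sM IH; rewrite -map_comp mulSn; have := pos _ _ sM.
  suff: sumn (map (eterm_size \o etsubst s) ts) <= sumn (map eterm_size ts) * M by lia.
  by apply: sumn_map_le; elim: ts IH => //= t ts IHts [/(_ _ _ sM) ? /IHts].
apply: e_induction => /= [n|f ts IH|A IH|p ts IH|A IH|A B IHA IHB|A B IHA IHB|A B IHA IHB] s M sM;
  have M0 := pos _ _ sM.
- by rewrite mul1n.
- exact: seq_case.
- have/IH: forall n, eterm_size (eup s n) <= M.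
    by case=> //= n; rewrite eren_size.1.
  by nia.
- exact: seq_case.
- by have := IH _ _ sM; nia.
- by have := IHA _ _ sM; have := IHB _ _ sM; nia.
- by have := IHA _ _ sM; have := IHB _ _ sM; nia.
- by have := IHA _ _ sM; have := IHB _ _ sM; nia.
Qed.

Lemma einst_size A t : eform_size (einst A t) <= eform_size A * eterm_size t.
Proof.
by apply: esubst_size.2 => -[|n] //=; apply: esize_gt0.1.
Qed.

(** * Cut-free epsilon proofs from propositional validity *)

Fixpoint Some_seq (T : Type) (P : T -> Prop) (s : seq T) : Prop :=
  if s is x :: s' then P x \/ Some_seq P s' else False.

Lemma All_seq_perm (T : Type) (P : T -> Prop) s s' :
  Permutation s s' -> All_seq P s -> All_seq P s'.
Proof. by elim=> //= *; tauto. Qed.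

Lemma Some_seq_perm (T : Type) (P : T -> Prop) s s' :
  Permutation s s' -> Some_seq P s -> Some_seq P s'.
Proof. by elim=> //= *; tauto. Qed.

Lemma All_seq_cat (T : Type) (P : T -> Prop) s s' :
  All_seq P (s ++ s') <-> All_seq P s /\ All_seq P s'.
Proof. by elim: s => //= [|x s IH]; tauto. Qed.

Lemma perm_cat_cons (T : Type) (x : T) s s' : Permutation (s ++ x :: s') (x :: s ++ s').
Proof. exact/Permutation_sym/Permutation_middle. Qed.

Lemma In_perm (T : Type) (x : T) s : List.In x s -> exists s', Permutation (x :: s') s.
Proof.
elim: s => //= y s IH [<-|/IH[s' ps]]; first by exists s; apply: Permutation_refl.
exists (y :: s'); exact: Permutation_trans (perm_swap _ _ _) (perm_skip _ ps).
Qed.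

(** A purely propositional reading: distinct atoms are independent, and epsilon terms have no
    meaning beyond their syntax. *)
Fixpoint ev (v : nat -> seq eterm -> Prop) (A : eform) : Prop :=
  match A with
  | EAtom p ts => v p ts
  | ENeg A => ~ ev v A
  | EAnd A B => ev v A /\ ev v B
  | EOr A B => ev v A \/ ev v B
  | EImp A B => ev v A -> ev v B
  end.

Definition valid (G D : seq eform) : Prop :=
  forall v, All_seq (ev v) G -> Some_seq (ev v) D.

Definition esizes (G : seq eform) : nat := sumn (map eform_size G).

Lemma esizes_cat G D : esizes (G ++ D) = esizes G + esizes D.
Proof. by rewrite /esizes map_cat sumn_cat. Qed.

Lemma esizes_perm G D : Permutation G D -> esizes G = esizes D.
Proof. by rewrite /esizes; elim=> //= *; lia. Qed.

Lemma esizes_cons A G : esizes (A :: G) = eform_size A + esizes G.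
Proof. by []. Qed.

Lemma size_le_esizes G : size G <= esizes G.
Proof.
by elim: G => // A G IH; rewrite esizes_cons /=; have := esize_gt0.2 A; lia.
Qed.

(* [h] bounds the number of inferences if all sequents have size at most [W]. *)
Definition Der (W h : nat) (S : sequent eform) : Prop :=
  exists p : Leps S, Leps_cut_free p /\ Leps_size p <= h * W.

Lemma Der_le W h h' S : h <= h' -> Der W h S -> Der W h' S.
Proof. by move=> le_h [p [cf le_p]]; exists p; split=> //; nia. Qed.

Section Rules.

Variable W : nat.

Ltac unary rule :=
  let le_W := fresh "le_W" in let p := fresh "p" in let cf := fresh "cf" in let le_p := fresh "le_p" in
  intros le_W [p [cf le_p]]; exists (rule p); split=> //=;
  move: le_W; rewrite /sequent_size /= /esizes /= => ?; nia.

Ltac binary rule :=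
  let le_W := fresh "le_W" in let p := fresh "p" in let q := fresh "q" in
  let cfp := fresh "cfp" in let cfq := fresh "cfq" in
  intros le_W [p [cfp ?]] [q [cfq ?]]; exists (rule p q); split=> /=;
  [by rewrite cfp cfq | move: le_W; rewrite /sequent_size /= /esizes /= => ?; nia].

Lemma Der_ax p ts : esizes [:: EAtom p ts] + esizes [:: EAtom p ts] < W ->
  Der W 1 ([:: EAtom p ts], [:: EAtom p ts]).
Proof.
by move=> le_W; exists (Leps_ax p ts); split=> //; rewrite mul1n /= addn0.
Qed.

Lemma Der_exch G G' D D' h :
  Permutation G G' -> Permutation D D' -> esizes G' + esizes D' < W ->
  Der W h (G, D) -> Der W h.+1 (G', D').
Proof. move=> pG pD; unary (Leps_exch pG pD). Qed.

Lemma Der_wl A G D h : esizes (A :: G) + esizes D < W ->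
  Der W h (G, D) -> Der W h.+1 (A :: G, D).
Proof. unary (@Leps_wl A G D). Qed.

Lemma Der_wr A G D h : esizes G + esizes (A :: D) < W ->
  Der W h (G, D) -> Der W h.+1 (G, A :: D).
Proof. unary (@Leps_wr A G D). Qed.

Lemma Der_cl A G D h : esizes (A :: G) + esizes D < W ->
  Der W h (A :: A :: G, D) -> Der W h.+1 (A :: G, D).
Proof. unary (@Leps_cl A G D). Qed.

Lemma Der_cr A G D h : esizes G + esizes (A :: D) < W ->
  Der W h (G, A :: A :: D) -> Der W h.+1 (G, A :: D).
Proof. unary (@Leps_cr A G D). Qed.

Lemma Der_negl A G D h : esizes (ENeg A :: G) + esizes D < W ->
  Der W h (G, A :: D) -> Der W h.+1 (ENeg A :: G, D).
Proof. unary (@Leps_negl A G D). Qed.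

Lemma Der_negr A G D h : esizes G + esizes (ENeg A :: D) < W ->
  Der W h (A :: G, D) -> Der W h.+1 (G, ENeg A :: D).
Proof. unary (@Leps_negr A G D). Qed.

Lemma Der_andl1 A B G D h : esizes (EAnd A B :: G) + esizes D < W ->
  Der W h (A :: G, D) -> Der W h.+1 (EAnd A B :: G, D).
Proof. unary (@Leps_andl1 A B G D). Qed.

Lemma Der_andl2 A B G D h : esizes (EAnd A B :: G) + esizes D < W ->
  Der W h (B :: G, D) -> Der W h.+1 (EAnd A B :: G, D).
Proof. unary (@Leps_andl2 A B G D). Qed.

Lemma Der_orr1 A B G D h : esizes G + esizes (EOr A B :: D) < W ->
  Der W h (G, A :: D) -> Der W h.+1 (G, EOr A B :: D).
Proof. unary (@Leps_orr1 A B G D). Qed.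

Lemma Der_orr2 A B G D h : esizes G + esizes (EOr A B :: D) < W ->
  Der W h (G, B :: D) -> Der W h.+1 (G, EOr A B :: D).
Proof. unary (@Leps_orr2 A B G D). Qed.

Lemma Der_impr A B G D h : esizes G + esizes (EImp A B :: D) < W ->
  Der W h (A :: G, B :: D) -> Der W h.+1 (G, EImp A B :: D).
Proof. unary (@Leps_impr A B G D). Qed.

Lemma Der_alll A t G D h : esizes (einst A (Eps (ENeg A)) :: G) + esizes D < W ->
  Der W h (einst A t :: G, D) -> Der W h.+1 (einst A (Eps (ENeg A)) :: G, D).
Proof. unary (@Leps_alll A t G D). Qed.

Lemma Der_exr A t G D h : esizes G + esizes (einst A (Eps A) :: D) < W ->
  Der W h (G, einst A t :: D) -> Der W h.+1 (G, einst A (Eps A) :: D).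
Proof. unary (@Leps_exr A t G D). Qed.

Lemma Der_andr_split A B G D P L h k : esizes (G ++ P) + esizes (EAnd A B :: D ++ L) < W ->
  Der W h (G, A :: D) -> Der W k (P, B :: L) ->
  Der W (h + k).+1 (G ++ P, EAnd A B :: D ++ L).
Proof. binary (@Leps_andr A B G D P L). Qed.

Lemma Der_orl_split A B G D P L h k : esizes (EOr A B :: G ++ P) + esizes (D ++ L) < W ->
  Der W h (A :: G, D) -> Der W k (B :: P, L) ->
  Der W (h + k).+1 (EOr A B :: G ++ P, D ++ L).
Proof. binary (@Leps_orl A B G D P L). Qed.

Lemma Der_impl_split A B G D P L h k : esizes (EImp A B :: G ++ P) + esizes (D ++ L) < W ->
  Der W h (G, A :: D) -> Der W k (B :: P, L) ->
  Der W (h + k).+1 (EImp A B :: G ++ P, D ++ L).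
Proof. binary (@Leps_impl A B G D P L). Qed.

Lemma Der_absorb_l A G D h : List.In A G -> esizes (A :: G) + esizes D < W ->
  Der W h (A :: G, D) -> Der W (h + 3) (G, D).
Proof.
move=> A_G le_W d; have [G' pG] := In_perm A_G.
have eG := esizes_perm pG; rewrite !esizes_cons in le_W eG.
rewrite addn3; apply: (Der_exch pG (Permutation_refl _)); first by lia.
apply: Der_cl; first by rewrite esizes_cons; lia.
apply: Der_exch (perm_skip _ (Permutation_sym pG)) (Permutation_refl _) _ d.
by rewrite !esizes_cons; lia.
Qed.

Lemma Der_absorb_r A G D h : List.In A D -> esizes G + esizes (A :: D) < W ->
  Der W h (G, A :: D) -> Der W (h + 3) (G, D).
Proof.
move=> A_D le_W d; have [D' pD] := In_perm A_D.
have eD := esizes_perm pD; rewrite !esizes_cons in le_W eD.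
rewrite addn3; apply: (Der_exch (Permutation_refl _) pD); first by lia.
apply: Der_cr; first by rewrite esizes_cons; lia.
apply: Der_exch (Permutation_refl _) (perm_skip _ (Permutation_sym pD)) _ d.
by rewrite !esizes_cons; lia.
Qed.

Lemma In_cat_r (T : Type) (x : T) s s' : List.In x s' -> List.In x (s ++ s').
Proof. by elim: s => //= y s IH /IH; right. Qed.

Lemma Der_merge G G' D D' h :
    (forall A, List.In A G -> List.In A G') -> (forall A, List.In A D -> List.In A D') ->
    esizes (G ++ G') + esizes (D ++ D') < W ->
  Der W h (G ++ G', D ++ D') -> Der W (h + 3 * (size G + size D)) (G', D').
Proof.
elim: G h => [|A G IH] h GG' DD' le_W d.
  elim: D h DD' le_W d => [|B D IH] h DD' le_W d.
    by apply: Der_le d; lia.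
  apply: (@Der_le _ (h + 3 + 3 * (size (@nil eform) + size D))); first by rewrite /=; lia.
  apply: IH => [C C_D||]; first by apply: DD'; right.
    by move: le_W; rewrite /= !esizes_cons; lia.
  by apply: Der_absorb_r le_W d; apply: In_cat_r; apply: DD'; left.
apply: (@Der_le _ (h + 3 + 3 * (size G + size D))); first by rewrite /=; lia.
apply: IH => // [C C_G||]; first by apply: GG'; right.
  by move: le_W; rewrite /= !esizes_cons; lia.
by apply: Der_absorb_l le_W d; apply: In_cat_r; apply: GG'; left.
Qed.

(** Binary rules split the context, so sharing it means contracting a second copy. Each contraction
    costs three inferences, and a sequent has no more formulas than symbols. *)
Lemma Der_double_l A G D h : 2 * (eform_size A + esizes G + esizes D) < W ->
  Der W h (A :: G ++ G, D ++ D) -> Der W (h + 3 * W) (A :: G, D).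
Proof.
move=> le_W d; have sG := size_le_esizes G; have sD := size_le_esizes D.
apply: (@Der_le _ (h.+1 + 3 * (size G + size D))); first by lia.
apply: Der_merge => //; first by move=> B; right.
  by rewrite !esizes_cat esizes_cons; lia.
apply: Der_exch d; [exact/Permutation_sym/perm_cat_cons|exact: Permutation_refl|].
by rewrite !esizes_cat esizes_cons; lia.
Qed.

Lemma Der_double_r A G D h : 2 * (eform_size A + esizes G + esizes D) < W ->
  Der W h (G ++ G, A :: D ++ D) -> Der W (h + 3 * W) (G, A :: D).
Proof.
move=> le_W d; have sG := size_le_esizes G; have sD := size_le_esizes D.
apply: (@Der_le _ (h.+1 + 3 * (size G + size D))); first by lia.
apply: Der_merge => //; first by move=> B; right.
  by rewrite !esizes_cat esizes_cons; lia.
apply: Der_exch d; [exact: Permutation_refl|exact/Permutation_sym/perm_cat_cons|].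
by rewrite !esizes_cat esizes_cons; lia.
Qed.

Lemma Der_andr A B G D h k : 2 * (eform_size (EAnd A B) + esizes G + esizes D) < W ->
  Der W h (G, A :: D) -> Der W k (G, B :: D) ->
  Der W (h + k + 3 * W).+1 (G, EAnd A B :: D).
Proof.
move=> le_W dA dB; rewrite -addSn; apply: Der_double_r => //.
by apply: Der_andr_split dA dB; rewrite esizes_cons !esizes_cat; lia.
Qed.

Lemma Der_orl A B G D h k : 2 * (eform_size (EOr A B) + esizes G + esizes D) < W ->
  Der W h (A :: G, D) -> Der W k (B :: G, D) ->
  Der W (h + k + 3 * W).+1 (EOr A B :: G, D).
Proof.
move=> le_W dA dB; rewrite -addSn; apply: Der_double_l => //.
by apply: Der_orl_split dA dB; rewrite esizes_cons !esizes_cat; lia.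
Qed.

Lemma Der_impl A B G D h k : 2 * (eform_size (EImp A B) + esizes G + esizes D) < W ->
  Der W h (G, A :: D) -> Der W k (B :: G, D) ->
  Der W (h + k + 3 * W).+1 (EImp A B :: G, D).
Proof.
move=> le_W dA dB; rewrite -addSn; apply: Der_double_l => //.
by apply: Der_impl_split dA dB; rewrite esizes_cons !esizes_cat; lia.
Qed.

Lemma Der_andl A B G D h : 2 * (eform_size (EAnd A B) + esizes G + esizes D) < W ->
  Der W h (A :: B :: G, D) -> Der W h.+4 (EAnd A B :: G, D).
Proof.
move=> le_W d; apply: Der_cl; first by rewrite esizes_cons; lia.
have le_A : eform_size (EAnd A B) = (eform_size A + eform_size B).+1 by [].
apply: Der_andl2; first by rewrite !esizes_cons; lia.
apply: Der_exch (perm_swap _ _ _) (Permutation_refl _) _ _.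
  by rewrite !esizes_cons; lia.
by apply: Der_andl1 d; rewrite !esizes_cons; lia.
Qed.

Lemma Der_orr A B G D h : 2 * (eform_size (EOr A B) + esizes G + esizes D) < W ->
  Der W h (G, A :: B :: D) -> Der W h.+4 (G, EOr A B :: D).
Proof.
move=> le_W d; apply: Der_cr; first by rewrite esizes_cons; lia.
have le_A : eform_size (EOr A B) = (eform_size A + eform_size B).+1 by [].
apply: Der_orr2; first by rewrite !esizes_cons; lia.
apply: Der_exch (Permutation_refl _) (perm_swap _ _ _) _ _.
  by rewrite !esizes_cons; lia.
by apply: Der_orr1 d; rewrite !esizes_cons; lia.
Qed.

Lemma Der_weaken G D G' D' h : esizes (G' ++ G) + esizes (D' ++ D) < W ->
  Der W h (G, D) -> Der W (h + size G' + size D') (G' ++ G, D' ++ D).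
Proof.
elim: G' => [|A G' IH] /= le_W d; last first.
  rewrite addnS addSn; apply: Der_wl => //; apply: IH => //.
  by move: le_W; rewrite esizes_cons; lia.
elim: D' le_W => [|B D' IH] /= le_W; first by rewrite !addn0.
rewrite addnS; apply: Der_wr => //; apply: IH.
by move: le_W; rewrite esizes_cons; lia.
Qed.

Definition is_eatom (A : eform) : bool := if A is EAtom _ _ then true else false.

Lemma split_nonatom G :
  all is_eatom G \/ exists A G', Permutation (A :: G') G /\ ~~ is_eatom A.
Proof.
elim: G => [|A G [IH|[B [G' [pG nB]]]]]; first by left.
  by case nA: (is_eatom A); [left; rewrite /= nA | right; exists A, G; rewrite nA].
right; exists B, (A :: G'); split=> //.
exact: Permutation_trans (perm_swap _ _ _) (perm_skip _ pG).
Qed.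

Lemma valid_perm G G' D D' : Permutation G' G -> Permutation D' D -> valid G D -> valid G' D'.
Proof.
move=> pG pD vGD v /(All_seq_perm pG)/vGD; exact/Some_seq_perm/Permutation_sym.
Qed.

Lemma Some_seq_In (T : Type) (P : T -> Prop) s :
  Some_seq P s -> exists2 x, List.In x s & P x.
Proof.
elim: s => //= x s IH [Px|/IH[y y_s Py]]; first by exists x; first by left.
by exists y; first by right.
Qed.

(** The valuation making true exactly the atoms of [G] exhibits an atom common to both sides; an
    axiom and weakenings finish. *)
Lemma Der_atomic G D : all is_eatom G -> all is_eatom D -> 2 * (esizes G + esizes D) < W ->
  valid G D -> Der W W.+2 (G, D).
Proof.
move=> aG aD le_W vGD; have [|A A_D A_G] := Some_seq_In (vGD (fun p ts => List.In (EAtom p ts) G) _).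
  have gen G' : all is_eatom G' -> (forall A, List.In A G' -> List.In A G) ->
      All_seq (ev (fun p ts => List.In (EAtom p ts) G)) G'.
    elim: G' => //= A G' IH /andP[aA aG'] sub; split; last first.
      by apply: IH => // B B_G; apply: sub; right.
    by case: A aA sub => // p ts _ sub /=; apply: sub; left.
  exact: gen.
have {}A_G : List.In A G /\ is_eatom A.
  suff aA : is_eatom A by case: A aA A_G {A_D}.
  by elim: D aD A_D {vGD le_W} => //= B D IH /andP[aB aD] [<-|/IH->].
case: A_G => A_G; case: A A_G A_D => // p ts A_G A_D _.
have [G' pG] := In_perm A_G; have [D' pD] := In_perm A_D.
have last_perm (L L' : seq eform) A : Permutation (A :: L') L -> Permutation (L' ++ [:: A]) L.
  by apply: Permutation_trans; have := perm_cat_cons A L' [::]; rewrite cats0.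
have {}pG := last_perm _ _ _ pG; have {}pD := last_perm _ _ _ pD.
have := esizes_perm pG; have := esizes_perm pD; rewrite !esizes_cat => sD sG.
have sG' := size_le_esizes G'; have sD' := size_le_esizes D'.
apply: (@Der_le _ (1 + size G' + size D').+1); first by lia.
apply: Der_exch pG pD _ _; first by lia.
apply: Der_weaken; first by rewrite !esizes_cat; lia.
by apply: Der_ax; lia.
Qed.

Fixpoint tree_cost (m : nat) : nat := if m is k.+1 then 4 * W + 6 + 2 * tree_cost k else W + 3.

Lemma tree_cost_S m : tree_cost m.+1 = 4 * W + 6 + 2 * tree_cost m.
Proof. by []. Qed.

Lemma tree_cost_gt m : W + 2 < tree_cost m.
Proof. by elim: m => [|m IH]; rewrite ?tree_cost_S /=; lia. Qed.

(** Backward search with invertible rules: every step removes a connective, hence lowers the total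
    size, and has at most two premises, which is the recursion of [tree_cost]. *)
Lemma Der_complete m G D : esizes G + esizes D <= m -> 2 * m < W -> valid G D ->
  Der W (tree_cost m) (G, D).
Proof.
elim: m G D => [|m IH] G D le_m lt_W vGD;
  (have [aG|[A [G' [pG nA]]]] := split_nonatom G;
  [have [aD|[A [D' [pD nA]]]] := split_nonatom D |]).
- by apply: Der_le (Der_atomic aG aD _ vGD) => //=; lia.
- by have := esizes_perm pD; rewrite esizes_cons; have := esize_gt0.2 A; lia.
- by have := esizes_perm pG; rewrite esizes_cons; have := esize_gt0.2 A; lia.
- by apply: Der_le (Der_atomic aG aD _ vGD) => //; have := tree_cost_gt m.+1; lia.
- have eD := esizes_perm pD; rewrite esizes_cons in eD.
  have {vGD} := valid_perm (Permutation_refl _) pD vGD.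
  have tm := tree_cost_gt m.
  case: A nA pD eD => [p ts|B|B C|B C|B C] // _ pD eD vGD;
    rewrite /= in eD; rewrite tree_cost_S; apply: (@Der_le _ (2 * tree_cost m + 3 * W + 4).+1); try lia;
    (apply: Der_exch (Permutation_refl _) pD _ _; first by lia).
  + apply: (@Der_le _ (tree_cost m).+1); first by lia.
    apply: Der_negr; first by rewrite esizes_cons /=; lia.
    apply: IH; rewrite ?esizes_cons; try lia.
    by move=> v /= [vB /vGD /=]; tauto.
  + apply: (@Der_le _ (tree_cost m + tree_cost m + 3 * W).+1); first by lia.
    apply: Der_andr => /=; first by lia.
      apply: IH; rewrite ?esizes_cons; try lia.
      by move=> v /vGD /=; tauto.
    apply: IH; rewrite ?esizes_cons; try lia.
    by move=> v /vGD /=; tauto.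
  + apply: (@Der_le _ (tree_cost m).+4); first by lia.
    apply: Der_orr => /=; first by lia.
    apply: IH; rewrite ?esizes_cons; try lia.
    by move=> v /vGD /=; tauto.
  + apply: (@Der_le _ (tree_cost m).+1); first by lia.
    apply: Der_impr; first by rewrite esizes_cons /=; lia.
    apply: IH; rewrite ?esizes_cons; try lia.
    by move=> v /= [vB /vGD /=]; tauto.
- have eG := esizes_perm pG; rewrite esizes_cons in eG.
  have {vGD} := valid_perm pG (Permutation_refl _) vGD.
  have tm := tree_cost_gt m.
  case: A nA pG eG => [p ts|B|B C|B C|B C] // _ pG eG vGD;
    rewrite /= in eG; rewrite tree_cost_S; apply: (@Der_le _ (2 * tree_cost m + 3 * W + 4).+1); try lia;
    (apply: Der_exch pG (Permutation_refl _) _ _; first by lia).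
  + apply: (@Der_le _ (tree_cost m).+1); first by lia.
    apply: Der_negl; first by rewrite esizes_cons /=; lia.
    apply: IH; rewrite ?esizes_cons; try lia.
    by move=> v /= vG; have := vGD v; have := classic (ev v B); rewrite /=; tauto.
  + apply: (@Der_le _ (tree_cost m).+4); first by lia.
    apply: Der_andl => /=; first by lia.
    apply: IH; rewrite ?esizes_cons; try lia.
    by move=> v /= vG; have := vGD v; rewrite /=; tauto.
  + apply: (@Der_le _ (tree_cost m + tree_cost m + 3 * W).+1); first by lia.
    apply: Der_orl => /=; first by lia.
      apply: IH; rewrite ?esizes_cons; try lia.
      by move=> v /=; have := vGD v; rewrite /=; tauto.
    apply: IH; rewrite ?esizes_cons; try lia.
    by move=> v /=; have := vGD v; rewrite /=; tauto.
  + apply: (@Der_le _ (tree_cost m + tree_cost m + 3 * W).+1); first by lia.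
    apply: Der_impl => /=; first by lia.
      apply: IH; rewrite ?esizes_cons; try lia.
      by move=> v /=; have := vGD v; have := classic (ev v B); rewrite /=; tauto.
    apply: IH; rewrite ?esizes_cons; try lia.
    by move=> v /=; have := vGD v; rewrite /=; tauto.
Qed.

End Rules.

(** * Critical formulas traded for tautologies *)

Definition critical (c : eform * eterm) : eform :=
  EImp (einst c.1 c.2) (einst c.1 (Eps c.1)).

Definition cut_taut (c : eform * eterm) : eform :=
  EImp (einst c.1 (Eps c.1)) (einst c.1 (Eps c.1)).

(** Covers both formulas that a premise may gain when the critical formula is removed, so that each
    removal lowers the total [m]. *)
Definition critical_size (c : eform * eterm) : nat :=
  eform_size (einst c.1 c.2) + eform_size (cut_taut c).

Lemma esizes_cut_taut C : esizes (map cut_taut C) <= sumn (map critical_size C).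
Proof. by elim: C => //= c C; rewrite esizes_cons /critical_size; lia. Qed.

(* Cutting on A(eps A) replaces the critical formula A(t) -> A(eps A) by the
   tautology A(eps A) -> A(eps A). *)
Lemma Der_critical W m C G D :
    sumn (map critical_size C) + esizes G + esizes D <= m -> 2 * m < W ->
    valid (map critical C ++ G) D ->
  Der W (tree_cost W m) (map cut_taut C ++ G, D).
Proof.
elim: C m G D => [|[A t] C IH] m G D; first by move=> le_m lt_W v; apply: Der_complete.
case: m => [|m] le_m lt_W vGD.
  by move: le_m; rewrite /= /critical_size /=; lia.
have le_m' : eform_size (einst A t) + 2 * eform_size (einst A (Eps A)) +
    sumn (map critical_size C) + esizes G + esizes D <= m.
  by move: le_m; rewrite /= /critical_size /=; lia.
have sC := esizes_cut_taut C; rewrite tree_cost_S.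
have gt_m := tree_cost_gt W m.
apply: (@Der_le _ ((tree_cost W m).+1 + (tree_cost W m).+1 + 3 * W).+1); first by lia.
rewrite map_cons cat_cons {1}/cut_taut [(_, _).1]/=.
apply: Der_impl; first by rewrite /= esizes_cat; lia.
  (* The left premise has to prove A(eps A), which comes from A(t). Where A(t) fails, the critical
     formula holds vacuously, so validity is kept; in the right premise it holds because A(eps A) is
     assumed. *)
  apply: (@Der_exr _ A t); first by rewrite esizes_cons esizes_cat; lia.
  apply: IH; rewrite ?esizes_cons; try lia.
  move=> v vG; have := vGD v; rewrite /=; have := classic (ev v (einst A t)); tauto.
have p := @perm_cat_cons _ (einst A (Eps A)) (map cut_taut C) G.
apply: (Der_exch p (Permutation_refl _)); first by rewrite esizes_cons esizes_cat; lia.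
apply: IH; rewrite ?esizes_cons; try lia.
move=> v /All_seq_cat[vC /= [vA vG]]; apply: vGD => /=; split=> //.
exact/All_seq_cat.
Qed.

(** * From instances to universal closures *)

Definition inst_env (ts : seq eterm) : nat -> eterm := foldr escons EVar ts.

(** An item pairs a matrix with the terms for its variables: the sequent contains the closure of the
    matrix, the propositional argument uses the instance. *)
Definition item_inst (it : fform * seq eterm) : eform :=
  efsubst (inst_env it.2) (eps_form it.1).

Definition item_closure (it : fform * seq eterm) : fform := iter (size it.2) All it.1.

(** Stage [j] on the way from the instance to the closure: the [j] innermost variables are already
    quantified, the others still carry their terms. *)
Definition partial_closure (j : nat) (it : fform * seq eterm) : eform :=
  efsubst (inst_env (drop j it.2)) (eps_form (iter j All it.1)).

Lemma partial_closureE it : partial_closure (size it.2) it = eps_form (item_closure it).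
Proof. by rewrite /partial_closure drop_size /= esubst_id.2. Qed.

Definition closure_bounded (b : nat) (it : fform * seq eterm) : Prop :=
  forall j, j <= size it.2 -> eform_size (partial_closure j it) <= b.

Lemma Der_partial_closure W b it G D h j :
    closure_bounded b it -> j <= size it.2 -> b + esizes G + esizes D < W ->
    Der W h (item_inst it :: G, D) ->
  Der W (h + j) (partial_closure j it :: G, D).
Proof.
move=> bd; elim: j => [|j IH] le_j lt_W d.
  by rewrite addn0 /partial_closure drop0.
have := bd _ le_j; rewrite addnS /partial_closure.
have := IH (ltnW le_j) lt_W d; rewrite /partial_closure.
rewrite (drop_nth (EVar 0) le_j) /=; move: (nth _ _ _) (inst_env _) (eps_form _) => t s B.
(* Stages j and j+1 are now instances of one body, at the term with index j and at the epsilon term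
   of the negated body, which is the shape of the left universal rule. *)
rewrite -einst_eup efsubst_einst /= => dB le_b.
by apply: Der_alll dB; rewrite esizes_cons; lia.
Qed.

Lemma Der_closures W b I G D h :
    All_seq (closure_bounded b) I -> size I * b + esizes G + esizes D < W ->
    Der W h (map item_inst I ++ G, D) ->
  Der W (h + sumn (map (fun it => (size it.2).+2) I))
    (map (eps_form \o item_closure) I ++ G, D).
Proof.
have es_inst J : All_seq (closure_bounded b) J -> esizes (map item_inst J) <= size J * b.
  elim: J => //= it J IH [bd /IH]; rewrite mulSn esizes_cons.
  have : eform_size (item_inst it) <= b by have := bd 0 isT; rewrite /partial_closure drop0.
  by lia.
have es_clos J : All_seq (closure_bounded b) J ->
    esizes (map (eps_form \o item_closure) J) <= size J * b.
  elim: J => //= it J IH [bd /IH]; rewrite mulSn esizes_cons.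
  have : eform_size (eps_form (item_closure it)) <= b.
    by have := bd _ (leqnn _); rewrite partial_closureE.
  by lia.
elim: I G h => [|it I IH] G h; first by rewrite addn0.
move=> [bd bdI]; rewrite [size _]/= mulSn !map_cons !cat_cons => lt_W d.
have [sI sC] := (es_inst _ bdI, es_clos _ bdI).
have si : eform_size (eps_form (item_closure it)) <= b.
  by have := bd _ (leqnn _); rewrite partial_closureE.
have {}d : Der W (h + size it.2) (eps_form (item_closure it) :: map item_inst I ++ G, D).
  rewrite -partial_closureE; apply: (Der_partial_closure bd) d => //.
  by rewrite esizes_cat; lia.
apply: (@Der_le _ (((h + size it.2).+1 +
  sumn [seq (size it0.2).+2 | it0 <- I])).+1); first by rewrite /=; lia.
have swap J := perm_cat_cons (eps_form (item_closure it)) J G.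
apply: (Der_exch (swap (map (eps_form \o item_closure) I)) (Permutation_refl D)).
  by rewrite esizes_cons esizes_cat; lia.
apply: IH => //; first by rewrite esizes_cons; lia.
have swap' := Permutation_sym (perm_cat_cons (eps_form (item_closure it)) (map item_inst I) G).
apply: (Der_exch swap' (Permutation_refl D)) d.
by rewrite esizes_cat esizes_cons; lia.
Qed.

Fixpoint eform_args (A : eform) : seq eterm :=
  match A with
  | EAtom _ ts => ts
  | ENeg A => eform_args A
  | EAnd A B | EOr A B | EImp A B => eform_args A ++ eform_args B
  end.

(** Each argument of an atom, epsilon term or not, is replaced by a variable of its own, numbered
    from [k]. The result is first-order and quantifier-free, and [A] is an instance of it. *)
Fixpoint eform_skeleton (k : nat) (A : eform) : fform :=
  match A with
  | EAtom p ts => Atom p (map Var (iota k (size ts)))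
  | ENeg A => Neg (eform_skeleton k A)
  | EAnd A B => And (eform_skeleton k A) (eform_skeleton (k + size (eform_args A)) B)
  | EOr A B => Or (eform_skeleton k A) (eform_skeleton (k + size (eform_args A)) B)
  | EImp A B => Imp (eform_skeleton k A) (eform_skeleton (k + size (eform_args A)) B)
  end.

Lemma inst_env_catr ts us n : inst_env (ts ++ us) (size ts + n) = inst_env us n.
Proof. by elim: ts. Qed.

Lemma inst_env_iota ts us vs :
  map (inst_env (ts ++ us ++ vs)) (iota (size ts) (size us)) = us.
Proof.
elim: us ts => //= u us IH ts; congr (_ :: _).
  by rewrite -[X in inst_env _ X]addn0 inst_env_catr.
by have := IH (rcons ts u); rewrite size_rcons cat_rcons.
Qed.

(** [ts] and [us] hold the arguments of the formulas to the left and to the right, as the induction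
    at binary connectives requires. *)
Lemma eform_skeletonK A ts us :
  efsubst (inst_env (ts ++ eform_args A ++ us)) (eps_form (eform_skeleton (size ts) A)) = A.
Proof.
elim: A ts us => //= [p vs|A IHA|A IHA B IHB|A IHA B IHB|A IHA B IHB] ts us.
- by rewrite -!map_comp (eq_map (g := inst_env (ts ++ vs ++ us))) ?inst_env_iota.
- by rewrite IHA.
- by have := IHB (ts ++ eform_args A) us; rewrite size_cat -!catA => ->; rewrite IHA.
- by have := IHB (ts ++ eform_args A) us; rewrite size_cat -!catA => ->; rewrite IHA.
- by have := IHB (ts ++ eform_args A) us; rewrite size_cat -!catA => ->; rewrite IHA.
Qed.

Definition taut_item (A : eform) : fform * seq eterm :=
  (Imp (eform_skeleton 0 A) (eform_skeleton 0 A), eform_args A).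

Lemma taut_item_inst A : item_inst (taut_item A) = EImp A A.
Proof.
by rewrite /item_inst /=; have := @eform_skeletonK A [::] [::]; rewrite cats0 => ->.
Qed.

Lemma eform_args_size A : size (eform_args A) <= eform_size A /\
  All_seq (fun t => eterm_size t <= eform_size A) (eform_args A).
Proof.
have mono (f g : nat) (s : seq eterm) : f <= g ->
    All_seq (fun t => eterm_size t <= f) s -> All_seq (fun t => eterm_size t <= g) s.
  by move=> le_fg; elim: s => //= t s IH [le_t /IH]; split=> //; lia.
have two B1 B2 C : size (eform_args B1) <= eform_size B1 /\
      All_seq (fun t => eterm_size t <= eform_size B1) (eform_args B1) ->
    size (eform_args B2) <= eform_size B2 /\
      All_seq (fun t => eterm_size t <= eform_size B2) (eform_args B2) ->
    eform_size C = (eform_size B1 + eform_size B2).+1 ->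
    size (eform_args B1 ++ eform_args B2) <= eform_size C /\
    All_seq (fun t => eterm_size t <= eform_size C) (eform_args B1 ++ eform_args B2).
  move=> [sA aA] [sB aB] ->; split; first by rewrite size_cat; lia.
  by apply/All_seq_cat; split; [apply: mono aA|apply: mono aB]; lia.
elim: A => [p ts|A [sA aA]|A IHA B IHB|A IHA B IHB|A IHA B IHB].
- split=> /=.
    apply: leqW; elim: ts => //= t ts IH.
    by have := esize_gt0.1 t; move: (eterm_size t) => k; lia.
  move: (leqnSn (sumn (map eterm_size ts))); move: (sumn _).+1 => m.
  by elim: ts => //= t ts IH le_m; split; [lia | apply: IH; lia].
- by split=> /=; [lia | apply: mono aA].
- exact: (two A B (EAnd A B)).
- exact: (two A B (EOr A B)).
- exact: (two A B (EImp A B)).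
Qed.

Lemma eform_skeleton_size A k : eform_size (eps_form (eform_skeleton k A)) <= eform_size A.
Proof.
elim: A k => [p ts|A IHA|A IHA B IHB|A IHA B IHB|A IHA B IHB] k /=; rewrite ltnS //;
  try exact: leq_add.
by elim: ts k => //= t ts IH k; have := esize_gt0.1 t; have := IH k.+1; lia.
Qed.

Lemma closure_size_bound V it :
    0 < V -> eform_size (eps_form it.1) <= V -> size it.2 <= V ->
    All_seq (fun t => eterm_size t <= V) it.2 ->
  closure_bounded ((V + 3) ^ 2 ^ V * V) it.
Proof.
move=> V0 le_G le_ts bd j le_j.
have env n ts : All_seq (fun t => eterm_size t <= V) ts -> eterm_size (inst_env ts n) <= V.
  by elim: ts n => [n _|t ts IH [|n] /= [le_t /IH]] //=.
apply: leq_trans (esubst_size.2 _ _ V _) _ => [n|].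
  apply: env; elim: (it.2) (j) bd => [|t ts IH] [|i] //= [_ bd]; exact: IH.
rewrite leq_mul2r; apply/orP; right.
(* A body of size d is instantiated with an epsilon term of size d + 3, and d(d + 3) + 3 is at most
   the square of d + 3. *)
have: eform_size (eps_form (iter j All it.1)) + 3 <= (V + 3) ^ 2 ^ j.
  elim: (j) => [|i IH]; first by rewrite expn1 leq_add2r.
  rewrite expnS mulnC expnM /=.
  have := einst_size (eps_form (iter i All it.1)) (Eps (ENeg (eps_form (iter i All it.1)))).
  by rewrite /=; nia.
have : (V + 3) ^ 2 ^ j <= (V + 3) ^ 2 ^ V.
  by rewrite leq_pexp2l ?leq_pexp2l //; lia.
by move: (_ ^ _) (_ ^ _) => x y; lia.
Qed.

(** * The sequents and their epsilon proofs *)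

Definition fzero : fterm := Fn 0 [::].
Definition fsucc (t : fterm) : fterm := Fn 1 [:: t].
(* p(x,w,z) says x + 2^w = z. *)
Definition fpow (x w z : fterm) : fform := Atom 0 [:: x; w; z].
Definition fmark (i : nat) (z : fterm) : fform := Atom i.+1 [:: z].

Definition ezero : eterm := EFn 0 [::].
Definition esucc (t : eterm) : eterm := EFn 1 [:: t].
Definition epow (x w z : eterm) : eform := EAtom 0 [:: x; w; z].
Definition emark (i : nat) (z : eterm) : eform := EAtom i.+1 [:: z].

(** The recursion equations of the relation: x + 2^0 is the successor of x, and adding 2^w twice
    adds 2^(w+1). *)
Definition succ_item (x : eterm) : fform * seq eterm :=
  (fpow (Var 0) fzero (fsucc (Var 0)), [:: x]).
Definition comp_item (x w u z : eterm) : fform * seq eterm :=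
  (Imp (fpow (Var 0) (Var 1) (Var 2))
    (Imp (fpow (Var 2) (Var 1) (Var 3)) (fpow (Var 0) (fsucc (Var 1)) (Var 3))),
   [:: x; w; u; z]).
Definition start_item (n : nat) : fform * seq eterm := (fmark n fzero, [::]).
Definition link_item (i : nat) (w z : eterm) : fform * seq eterm :=
  (Imp (fmark i.+1 (Var 0)) (Imp (fpow fzero (Var 0) (Var 1)) (fmark i (Var 1))),
   [:: w; z]).
Definition stop_item (z : eterm) : fform * seq eterm := (Neg (fmark 0 (Var 0)), [:: z]).

(* [level i w] is the translation of Orevkov's formula A_i(w), where A_0 is
   trivial and A_(i+1)(w) is forall x, A_i(x) -> exists z, A_i(z) /\ p(x,w,z).
   [ex_body i x w] is the body of exists z and [all_body i w] that of forall x. *)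
Definition ex_body_of (level : eterm -> eform) (x w : eterm) : eform :=
  ENeg (EImp (level (EVar 0)) (ENeg (epow (etren succn x) (etren succn w) (EVar 0)))).

Definition all_body_of (level : eterm -> eform) (w : eterm) : eform :=
  let E := ex_body_of level (EVar 0) (etren succn w) in
  EImp (level (EVar 0)) (einst E (Eps E)).

Fixpoint level (i : nat) (w : eterm) : eform :=
  if i is j.+1 then
    let B := all_body_of (level j) w in einst B (Eps (ENeg B))
  else EImp (epow w w w) (epow w w w).

Definition ex_body i := ex_body_of (level i).
Definition ex_wit i x w : eterm := Eps (ex_body i x w).
Definition ex_form i x w : eform := einst (ex_body i x w) (ex_wit i x w).
Definition all_body i := all_body_of (level i).
Definition all_wit i w : eterm := Eps (ENeg (all_body i w)).

Lemma efsubst_ex_body i s x w :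
    (forall s w, efsubst s (level i w) = level i (etsubst s w)) ->
  efsubst (eup s) (ex_body i x w) = ex_body i (etsubst s x) (etsubst s w).
Proof.
by move=> IH; rewrite /ex_body /ex_body_of /= IH /= !etsubst_eup_shift.
Qed.

Lemma etsubst_Eps s A : etsubst s (Eps A) = Eps (efsubst (eup s) A).
Proof. by []. Qed.

Lemma efsubst_ENeg s A : efsubst s (ENeg A) = ENeg (efsubst s A).
Proof. by []. Qed.

Lemma efsubst_EImp s A B : efsubst s (EImp A B) = EImp (efsubst s A) (efsubst s B).
Proof. by []. Qed.

Lemma efsubst_ex_form i s x w :
    (forall s w, efsubst s (level i w) = level i (etsubst s w)) ->
  efsubst s (ex_form i x w) = ex_form i (etsubst s x) (etsubst s w).
Proof.
by move=> IH; rewrite /ex_form /ex_wit efsubst_einst etsubst_Eps efsubst_ex_body.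
Qed.

Lemma all_bodyE i w :
  all_body i w = EImp (level i (EVar 0)) (ex_form i (EVar 0) (etren succn w)).
Proof. by []. Qed.

Lemma levelS i w : level i.+1 w = einst (all_body i w) (all_wit i w).
Proof. by []. Qed.

(** Substitution reaches into the nested epsilon terms only through [w], so [level i] may be handled
    like an atom with a parameter. *)
Lemma efsubst_level i s w : efsubst s (level i w) = level i (etsubst s w).
Proof.
elim: i s w => // i IH s w; rewrite !levelS /all_wit efsubst_einst etsubst_Eps.
have E : efsubst (eup s) (all_body i w) = all_body i (etsubst s w).
  by rewrite !all_bodyE efsubst_EImp efsubst_ex_form // IH etsubst_eup_shift.
by rewrite efsubst_ENeg E.
Qed.

Lemma einst_ex_body i x w t :
  einst (ex_body i x w) t = ENeg (EImp (level i t) (ENeg (epow x w t))).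
Proof.
by rewrite /ex_body /ex_body_of einstE /= efsubst_level /= !einst_shift.
Qed.

Lemma ex_formE i x w :
  ex_form i x w =
  ENeg (EImp (level i (ex_wit i x w)) (ENeg (epow x w (ex_wit i x w)))).
Proof. exact: einst_ex_body. Qed.

Lemma einst_all_body i w t :
  einst (all_body i w) t = EImp (level i t) (ex_form i t w).
Proof.
rewrite all_bodyE einstE efsubst_EImp efsubst_level efsubst_ex_form; last exact: efsubst_level.
by rewrite /= einst_shift.
Qed.

Definition ex_crit i x w t : eform * eterm := (ex_body i x w, t).
Definition all_crit i w t : eform * eterm := (ENeg (all_body i w), t).

Lemma ev_ex_crit v i x w t : ev v (critical (ex_crit i x w t)) ->
  ev v (level i t) -> ev v (epow x w t) -> ev v (ex_form i x w).
Proof.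
have -> : critical (ex_crit i x w t) = EImp (einst (ex_body i x w) t) (ex_form i x w) by [].
by rewrite einst_ex_body /=; tauto.
Qed.

Lemma ev_ex_form v i x w : ev v (ex_form i x w) ->
  ev v (level i (ex_wit i x w)) /\ ev v (epow x w (ex_wit i x w)).
Proof. by rewrite ex_formE /= => H; split; apply: NNPP; tauto. Qed.

(** A universal quantifier uses the critical formula of the negated body: read contrapositively,
    B(eps not-B) implies B(t). *)
Lemma ev_all_crit v i w t : ev v (critical (all_crit i w t)) ->
  ev v (level i.+1 w) -> ev v (level i t) -> ev v (ex_form i t w).
Proof.
have -> : critical (all_crit i w t) =
    EImp (ENeg (einst (all_body i w) t)) (ENeg (level i.+1 w)) by [].
by rewrite einst_all_body /= => H1 H2 H3; apply: NNPP; tauto.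
Qed.

Lemma ev_levelS v i w :
  (ev v (level i (all_wit i w)) -> ev v (ex_form i (all_wit i w) w)) ->
  ev v (level i.+1 w).
Proof. by rewrite levelS einst_all_body. Qed.

(** The passage from A_(j+1)(w) to A_(j+1)(w+1): for x in A_j, the hypothesis used at x gives u = x
    + 2^w in A_j, used at u it gives z = u + 2^w in A_j, and [comp_item] turns this into z = x +
    2^(w+1). At index 0 nothing is required. *)
Definition step_crits (i : nat) (w : eterm) : seq (eform * eterm) :=
  if i is j.+1 then
    let x := all_wit j (esucc w) in let u := ex_wit j x w in let z := ex_wit j u w in
    [:: all_crit j w x; all_crit j w u; ex_crit j x (esucc w) z]
  else [::].

Definition step_items (i : nat) (w : eterm) : seq (fform * seq eterm) :=
  if i is j.+1 then
    let x := all_wit j (esucc w) in let u := ex_wit j x w in let z := ex_wit j u w in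
    [:: comp_item x w u z]
  else [::].

Definition holds (v : nat -> seq eterm -> Prop) (C : seq (eform * eterm))
    (I : seq (fform * seq eterm)) : Prop :=
  All_seq (ev v) (map critical C) /\ All_seq (ev v) (map item_inst I).

Lemma holds_cat v C C' I I' :
  holds v (C ++ C') (I ++ I') <-> holds v C I /\ holds v C' I'.
Proof. by rewrite /holds !map_cat !All_seq_cat; tauto. Qed.

Lemma ev_step v i w : holds v (step_crits i w) (step_items i w) ->
  ev v (level i w) -> ev v (level i (esucc w)).
Proof.
case: i => [|i]; first by move=> _ _ /=.
move=> [[c1 [c2 [c3 _]]] [a _]] Aw; apply: ev_levelS => Ax.
have [Au pu] := ev_ex_form (ev_all_crit c1 Aw Ax).
have [Az pz] := ev_ex_form (ev_all_crit c2 Aw Au).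
exact: (ev_ex_crit c3 Az (a pu pz)).
Qed.

(** A_(j+1)(0): for x in A_j the witness is the successor of x, which lies in A_j by the step
    argument and equals x + 2^0 by [succ_item]. *)
Definition zero_crits (i : nat) : seq (eform * eterm) :=
  if i is j.+1 then
    let x := all_wit j ezero in ex_crit j x ezero (esucc x) :: step_crits j x
  else [::].

Definition zero_items (i : nat) : seq (fform * seq eterm) :=
  if i is j.+1 then
    let x := all_wit j ezero in succ_item x :: step_items j x
  else [::].

Lemma ev_zero v i : holds v (zero_crits i) (zero_items i) -> ev v (level i ezero).
Proof.
case: i => [|i]; first by move=> _ /=.
move=> [[c1 cs] [a as_]]; apply: ev_levelS => Ax.
exact: (ev_ex_crit c1 (ev_step (conj cs as_) Ax) a).
Qed.

(** From A_(j+1)(w) with mark j+1 at w, used at 0 in A_j: some z = 2^w lies in A_j, and the link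
    axiom marks it with j. The descent ends at mark 0, against [stop_item]. *)
Fixpoint chain_crits (i : nat) (w : eterm) : seq (eform * eterm) :=
  if i is j.+1 then
    [:: all_crit j w ezero] ++ zero_crits j ++ chain_crits j (ex_wit j ezero w)
  else [::].

Fixpoint chain_items (i : nat) (w : eterm) : seq (fform * seq eterm) :=
  if i is j.+1 then
    [:: link_item j w (ex_wit j ezero w)] ++ zero_items j ++
      chain_items j (ex_wit j ezero w)
  else [:: stop_item w].

Lemma ev_chain v i w : holds v (chain_crits i w) (chain_items i w) ->
  ev v (level i w) -> ev v (emark i w) -> False.
Proof.
elim: i w => [|i IH] w; first by case=> _ [/= nm _] _.
move=> /holds_cat[[/= [c1 _] [a1 _]] /holds_cat[/ev_zero A0 /IH{}IH]] Aw qw.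
have [Az pz] := ev_ex_form (ev_all_crit c1 Aw A0).
by apply: IH => //; apply: a1.
Qed.

Definition orevkov_crits (n : nat) : seq (eform * eterm) :=
  zero_crits n ++ chain_crits n ezero.

(* The leading [succ_item] and [comp_item] are idle in the epsilon proof: they make
   these axioms available in LK for every [n]. *)
Definition orevkov_items (n : nat) : seq (fform * seq eterm) :=
  [:: start_item n; succ_item ezero; comp_item ezero ezero ezero ezero] ++
  zero_items n ++ chain_items n ezero.

Lemma orevkov_valid n :
  valid (map critical (orevkov_crits n) ++ map item_inst (orevkov_items n)) [::].
Proof.
move=> v /All_seq_cat[vC /=[q0 [_ [_ vI]]]].
have /holds_cat[/ev_zero A0 /ev_chain] : holds v (orevkov_crits n) (zero_items n ++ chain_items n ezero).
  by [].
exact.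
Qed.

Definition tautologies (n : nat) : seq (fform * seq eterm) :=
  map (fun c => taut_item (einst c.1 (Eps c.1))) (orevkov_crits n).

Definition orevkov_sequent (n : nat) : sequent fform :=
  (map item_closure (tautologies n ++ orevkov_items n), [::]).

(** * Size bounds for critical formulas, closures and proofs *)

Lemma All_seq_impl (T : Type) (P Q : T -> Prop) s :
  (forall x, P x -> Q x) -> All_seq P s -> All_seq Q s.
Proof. by move=> PQ; elim: s => //= x s IH [/PQ ? /IH]. Qed.

Definition level_size (i : nat) : nat := eform_size (level i (EVar 0)).

Lemma ex_body_size i x w :
  eform_size (ex_body i x w) = level_size i + eterm_size x + eterm_size w + 5.
Proof. by rewrite /ex_body /ex_body_of /= !eren_size.1 -/(level_size i); lia. Qed.

Lemma ex_wit_size i x w :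
  eterm_size (ex_wit i x w) = level_size i + eterm_size x + eterm_size w + 7.
Proof.
have -> : eterm_size (ex_wit i x w) = (eform_size (ex_body i x w)).+2 by [].
by rewrite ex_body_size; lia.
Qed.

Section LevelSizes.

Variables (i u : nat).
Hypotheses (u20 : 20 <= u) (level_u : level_size i <= u).

Lemma ex_form_size x w : eterm_size x <= u -> eterm_size w <= u ->
  eform_size (ex_form i x w) <= 16 * (u * u).
Proof.
move=> le_x le_w; have := einst_size (ex_body i x w) (ex_wit i x w).
rewrite -/(ex_form i x w) ex_body_size ex_wit_size.
have : level_size i + eterm_size x + eterm_size w + 5 <= 4 * u by lia.
have : level_size i + eterm_size x + eterm_size w + 7 <= 4 * u by lia.
by move: (_ + 5) (_ + 7) => a b; nia.
Qed.

Lemma all_body_size w : eterm_size w <= u ->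
  eform_size (all_body i w) <= level_size i + 16 * (u * u) + 1.
Proof.
move=> le_w; have := @ex_form_size (EVar 0) (etren succn w).
rewrite eren_size.1 => /(_ _ le_w); rewrite all_bodyE /= -/(level_size i).
by move=> /(_ (ltnW (ltnW (leq_trans _ u20)))); lia.
Qed.

Lemma all_wit_size w : eterm_size w <= u -> eterm_size (all_wit i w) <= u ^ 3.
Proof.
move=> /all_body_size; have -> : eterm_size (all_wit i w) = (eform_size (all_body i w)).+3 by [].
by rewrite !expnS expn0 muln1; move: level_u => ? ?; nia.
Qed.

Lemma ex_crit_size x w t : eterm_size x <= u -> eterm_size w <= u -> eterm_size t <= u ->
  critical_size (ex_crit i x w t) <= u ^ 7.
Proof.
move=> le_x le_w le_t; have := ex_form_size le_x le_w.
have -> : critical_size (ex_crit i x w t) = eform_size (einst (ex_body i x w) t) +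
  (eform_size (ex_form i x w) + eform_size (ex_form i x w)).+1 by [].
have := einst_size (ex_body i x w) t; rewrite ex_body_size.
have : u * (u * (u * u)) <= u ^ 7.
  by rewrite (_ : u * (u * (u * u)) = u ^ 4) ?leq_pexp2l //; lia.
move: (u ^ 7) (eform_size (einst _ _)) (eform_size (ex_form _ _ _)) => U a b le_U le_a le_b.
have : level_size i + eterm_size x + eterm_size w + 5 <= 4 * u by lia.
by move: (_ + 5) le_a => q; nia.
Qed.

Lemma all_crit_size w t : eterm_size w <= u -> eterm_size t <= u ->
  critical_size (all_crit i w t) <= u ^ 7.
Proof.
move=> le_w le_t; have := all_body_size le_w; have := all_wit_size le_w.
pose B := ENeg (all_body i w).
have -> : critical_size (all_crit i w t) = eform_size (einst B t) +
  (eform_size (einst B (all_wit i w)) + eform_size (einst B (all_wit i w))).+1 by [].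
have := einst_size B t; have := einst_size B (all_wit i w).
have -> : eform_size B = (eform_size (all_body i w)).+1 by [].
move: (eform_size (einst B t)) (eform_size (einst B _)) (eterm_size (all_wit _ _)) => b a c.
move: (eform_size (all_body i w)) => d le_a le_b le_c le_d.
have {}le_d : d < u ^ 3 by rewrite !expnS expn0 muln1; move: level_u => *; nia.
have {}le_a : a <= u ^ 6 by rewrite (expnD u 3 3); apply: leq_trans le_a _; apply: leq_mul.
have {}le_b : b <= u ^ 6.
  rewrite (expnD u 3 3); apply: leq_trans le_b _; apply: leq_mul => //.
  by apply: leq_trans le_t _; rewrite -[X in X <= _]expn1 leq_pexp2l //; lia.
by rewrite expnS; move: (u ^ 6) le_a le_b (expn_gt0 u 6) => U *; nia.
Qed.

End LevelSizes.

(** Each level substitutes a witness of size at most [u ^ 3] into a body of size at most [u ^ 3],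
    which raises the bound [u] to the sixth power. *)
Definition level_bound (n : nat) : nat := 20 ^ 6 ^ n.

Lemma level_bound_ge20 n : 20 <= level_bound n.
Proof. by rewrite -[X in X <= _]expn1 leq_pexp2l // expn_gt0. Qed.

Lemma level_size_bound n : level_size n <= level_bound n.
Proof.
elim: n => [|n IH]; first by rewrite /level_size.
rewrite /level_size levelS; apply: leq_trans (einst_size _ _) _.
have u20 := level_bound_ge20 n; have u1 : 1 <= level_bound n by lia.
rewrite (_ : level_bound n.+1 = level_bound n ^ 3 * level_bound n ^ 3); last first.
  by rewrite -expnD -expnM mulnC -expnS.
apply: leq_mul; last exact: (all_wit_size u20 IH).
have := @all_wit_size _ _ u20 IH (EVar 0) u1.
have -> : eterm_size (all_wit n (EVar 0)) = (eform_size (all_body n (EVar 0))).+3 by [].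
by lia.
Qed.

Lemma level_bound_mono m n : m <= n -> level_bound m <= level_bound n.
Proof. by move=> le_mn; rewrite leq_pexp2l // leq_pexp2l. Qed.

Lemma level_size_le_bound j n : j <= n -> level_size j <= level_bound n.
Proof. by move=> le_jn; apply: leq_trans (level_size_bound j) (level_bound_mono le_jn). Qed.

Definition item_small (V : nat) (it : fform * seq eterm) : Prop :=
  [/\ eform_size (eps_form it.1) <= V, size it.2 <= V &
      All_seq (fun t => eterm_size t <= V) it.2].

Definition small (V : nat) (C : seq (eform * eterm)) (I : seq (fform * seq eterm)) : Prop :=
  All_seq (fun c => critical_size c <= V) C /\ All_seq (item_small V) I.

Lemma small_cat V C C' I I' : small V C I -> small V C' I' -> small V (C ++ C') (I ++ I').
Proof. by move=> [? ?] [? ?]; split; apply/All_seq_cat. Qed.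

Lemma small_le V V' C I : V <= V' -> small V C I -> small V' C I.
Proof.
move=> le_V [sC sI]; split; first by apply: All_seq_impl sC => c; lia.
apply: All_seq_impl sI => it [? ? st]; split; try lia.
by apply: All_seq_impl st => t; lia.
Qed.

Lemma leq_self_exp u k : 0 < u -> 0 < k -> u <= u ^ k.
Proof. by move=> u0 k0; rewrite -[X in X <= _]expn1 leq_pexp2l. Qed.

(** The exponent 42 is 6 * 7: the terms have size at most [u ^ 6], and the critical formulas over
    them add a seventh power. The 126 used below is 3 * 42, as [all_wit] first has size up to
    [u ^ 3]. *)
Lemma small_step i u w : 20 <= u -> (forall j, j < i -> level_size j <= u) ->
  eterm_size w <= u -> small (u ^ 42) (step_crits i w) (step_items i w).
Proof.
case: i => // i u20 /(_ i (ltnSn i)) le_u le_w; have pos : 0 < u by lia.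
rewrite (expnM u 6 7) /=; set x := all_wit i (esucc w); set y := ex_wit i x w.
set z := ex_wit i y w.
have le_x : eterm_size x <= u ^ 4.
  apply: leq_trans (@all_wit_size i (2 * u) _ _ (esucc w) _) _; try by rewrite /=; lia.
  by rewrite expnMn (expnS u 3) leq_mul2r; apply/orP; right; lia.
have le_u4 : u <= u ^ 4 by apply: leq_self_exp.
have le_y : eterm_size y <= u ^ 5.
  by rewrite ex_wit_size (expnS u 4); move: (u ^ 4) le_x le_u4 => t *; nia.
have le_45 : u ^ 4 <= u ^ 5 by rewrite leq_pexp2l.
have le_z : eterm_size z <= u ^ 6.
  by rewrite ex_wit_size (expnS u 5); move: (u ^ 4) (u ^ 5) le_y le_u4 le_45 => t t' *; nia.
have le_56 : u ^ 5 <= u ^ 6 by rewrite leq_pexp2l.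
have le_Sw : eterm_size (esucc w) <= u ^ 6.
  have : u * u <= u ^ 6 by rewrite mulnn leq_pexp2l.
  by rewrite /=; nia.
move: (u ^ 4) (u ^ 5) (u ^ 6) le_x le_u4 le_y le_45 le_z le_56 le_Sw => u4 u5 U *.
clearbody z y x.
have le_U : U <= U ^ 7 by apply: leq_self_exp; lia.
split; last by split=> //; split; rewrite /=; [lia | lia | repeat split; lia].
split; first by apply: all_crit_size; lia.
split; first by apply: all_crit_size; lia.
by split=> //; apply: ex_crit_size; lia.
Qed.

Lemma small_zero i u : 20 <= u -> (forall j, j < i -> level_size j <= u) ->
  small (u ^ 126) (zero_crits i) (zero_items i).
Proof.
case: i => // i u20 le_u; have pos : 0 < u by lia.
have le_i := le_u i (ltnSn i); set x := all_wit i ezero.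
have le_x : eterm_size x <= u ^ 3 by apply: all_wit_size => //=; lia.
change (small (u ^ 126) (ex_crit i x ezero (esucc x) :: step_crits i x)
  (succ_item x :: step_items i x)).
clearbody x.
have le_u3 : u <= u ^ 3 by apply: leq_self_exp.
have sm : small (u ^ 126) (step_crits i x) (step_items i x).
  rewrite (expnM u 3 42); apply: small_step => //; first by lia.
  by move=> j lt_j; apply: leq_trans le_u3; apply: le_u; lia.
have le_u4 : eterm_size (esucc x) <= u ^ 4.
  by rewrite /= expnS; move: (u ^ 3) le_x le_u3 => t *; nia.
have le_4 : u <= u ^ 4 by apply: leq_self_exp.
have le_34 : u ^ 3 <= u ^ 4 by rewrite leq_pexp2l.
have le_4_126 : u ^ 4 <= u ^ 126 by rewrite leq_pexp2l.
have le_428 : (u ^ 4) ^ 7 <= u ^ 126 by rewrite -expnM leq_pexp2l.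
move: (u ^ 126) (u ^ 4) (u ^ 3) sm le_x le_u3 le_u4 le_4 le_34 le_4_126 le_428.
move=> V u4 u3 sm le_x le_u3 le_u4 le_4 le_34 le_4_126 le_428.
apply: (@small_cat _ [:: ex_crit i x ezero (esucc x)] _ [:: succ_item x] _ _ sm).
split; split=> //.
  by apply: leq_trans le_428; apply: ex_crit_size => //; rewrite /=; lia.
by split; rewrite /=; [lia | lia | split; lia].
Qed.

(** Along the chain the terms grow only additively, by at most [2 * u] per link, so one bound [U]
    serves all links. *)
Lemma small_chain i u U w : 20 <= u -> (forall j, j < i -> level_size j <= u) ->
  eterm_size w + 2 * u * i.+1 <= U -> small (U ^ 126) (chain_crits i w) (chain_items i w).
Proof.
move=> u20; elim: i w => [|i IH] w le_u le_U; have U0 : 20 <= U by nia.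
  split=> //; have := @leq_self_exp U 126; move: (U ^ 126) => V le_V; split=> //.
  by split; rewrite /=; [lia | lia | split=> //; lia].
have pos : 0 < U by lia.
apply: (@small_cat _ [:: all_crit i w ezero] _ [:: link_item i w (ex_wit i ezero w)]).
  split; split=> //.
    apply: leq_trans (_ : U ^ 7 <= _); last by rewrite leq_pexp2l.
    by apply: all_crit_size; rewrite /=; have := le_u i (ltnSn i); nia.
  have := ex_wit_size i ezero w; rewrite [eterm_size ezero]/= => le_z.
  have := @leq_self_exp U 126 pos isT; move: (U ^ 126) => V le_V.
  have le_i := le_u i (ltnSn i).
  split; [by rewrite /=; lia | by rewrite /=; lia | split; [| split=> //]].
    by nia.
  by rewrite le_z; nia.
apply: small_cat.
  apply: small_zero => // j lt_j.
  by apply: leq_trans (le_u j _) _; [lia | nia].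
apply: IH => [j lt_j|]; first by apply: le_u; lia.
rewrite ex_wit_size /=; have := le_u i (ltnSn i); nia.
Qed.

Definition term_bound (n : nat) : nat := 1 + 2 * level_bound n * n.+1.
Definition orevkov_bound (n : nat) : nat := term_bound n ^ 126.

Lemma small_orevkov n : small (orevkov_bound n) (orevkov_crits n) (orevkov_items n).
Proof.
have u20 := level_bound_ge20 n.
have le_u j : j < n -> level_size j <= level_bound n by move=> /ltnW/level_size_le_bound.
have le_U : level_bound n <= term_bound n by rewrite /term_bound; nia.
have ge20 : 20 <= orevkov_bound n.
  by apply: leq_trans (leq_trans u20 le_U) _; apply: leq_self_exp; lia.
apply: (@small_cat _ [::] _ [:: start_item n; succ_item ezero; comp_item ezero ezero ezero ezero]).
  by split=> //; move: (orevkov_bound n) ge20 => V *; do ![split]; rewrite /=; lia.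
apply: small_cat; last by apply: small_chain u20 le_u _.
apply: small_le (small_zero u20 le_u).
by rewrite /orevkov_bound leq_exp2r.
Qed.

Lemma size_zero i : size (zero_crits i) <= 4 /\ size (zero_items i) <= 2.
Proof. by case: i => [|[|i]]. Qed.

Lemma size_chain i w :
  size (chain_crits i w) <= 5 * i /\ size (chain_items i w) <= 3 * i + 1.
Proof.
elim: i w => // i IH w; have [c1 i1] := IH (ex_wit i ezero w); have [c2 i2] := size_zero i.
by rewrite /= !size_cat; lia.
Qed.

Lemma size_orevkov n :
  size (orevkov_crits n) + size (orevkov_items n) <= 2 * orevkov_bound n.
Proof.
have [c1 i1] := size_zero n; have [c2 i2] := size_chain n ezero.
rewrite /orevkov_crits /orevkov_items !size_cat /=.
have : term_bound n <= orevkov_bound n by apply: leq_self_exp.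
by have := level_bound_ge20 n; rewrite /term_bound; nia.
Qed.

Lemma small_tautologies n : All_seq (item_small (orevkov_bound n)) (tautologies n).
Proof.
have [sC _] := small_orevkov n; rewrite /tautologies.
elim: (orevkov_crits n) sC => //= c C IH [sc /IH]; split=> //.
have [s1 s2] := eform_args_size (einst c.1 (Eps c.1)).
move: sc; rewrite /critical_size /cut_taut /= => sc; split=> /=.
- have := eform_skeleton_size (einst c.1 (Eps c.1)) 0; lia.
- by lia.
- by apply: All_seq_impl s2 => t; lia.
Qed.

Definition closure_bound (n : nat) : nat :=
  (orevkov_bound n + 3) ^ 2 ^ orevkov_bound n * orevkov_bound n.

Definition sequent_bound (n : nat) : nat :=
  10 * (orevkov_bound n * orevkov_bound n + orevkov_bound n * closure_bound n) + 10.

(** Number of inferences times the bound on sequents: the first summand covers the propositional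
    proof, the second the introduction of quantifiers. *)
Definition proof_bound (n : nat) : nat :=
  (9 * sequent_bound n * 2 ^ sequent_bound n + 9 * orevkov_bound n * orevkov_bound n)
  * sequent_bound n.

Lemma tree_cost_le W m : tree_cost W m <= (5 * W + 9) * 2 ^ m.
Proof.
suff : tree_cost W m + (4 * W + 6) <= (5 * W + 9) * 2 ^ m by lia.
elim: m => [|m IH]; first by rewrite expn0 /=; lia.
by rewrite tree_cost_S expnS; lia.
Qed.

Lemma sumn_le_mul (T : Type) (f : T -> nat) V s :
  All_seq (fun x => f x <= V) s -> sumn (map f s) <= size s * V.
Proof. by elim: s => //= x s IH [? /IH]; rewrite mulSn; lia. Qed.

Lemma orevkov_Leps n : exists p : Leps (eps_sequent (orevkov_sequent n)),
  Leps_cut_free p /\ Leps_size p <= proof_bound n.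
Proof.
set V := orevkov_bound n; set b := closure_bound n; set W := sequent_bound n.
have [sC sI] := small_orevkov n; have sT := small_tautologies n.
have sz := size_orevkov n; have V0 : 0 < V by rewrite expn_gt0.
have clos I : All_seq (item_small V) I -> All_seq (closure_bounded b) I.
  by apply: All_seq_impl => it [? ? ?]; apply: closure_size_bound.
pose I := tautologies n ++ orevkov_items n.
have sall : All_seq (item_small V) I by apply/All_seq_cat.
have szI : size I <= 2 * V by rewrite size_cat size_map.
have esI : esizes (map item_inst (orevkov_items n)) <= 2 * V * b.
  apply: leq_trans (@sumn_le_mul _ eform_size b _ _) _.
    elim: (orevkov_items n) (clos _ sI) => //= it J IH [bd /IH]; split=> //.
    by have := bd 0 isT; rewrite /partial_closure drop0.
  by rewrite size_map leq_mul2r; apply/orP; right; lia.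
have szC := sumn_le_mul sC.
pose m := 2 * V * V + 2 * V * b.
have d : Der W (tree_cost W m)
    (map cut_taut (orevkov_crits n) ++ map item_inst (orevkov_items n), [::]).
  apply: Der_critical (@orevkov_valid n); last by rewrite /W /sequent_bound -/V -/b; lia.
  rewrite addn0; apply: leq_add esI; apply: leq_trans szC _.
  by rewrite leq_mul2r; apply/orP; right; lia.
have {}d : Der W (tree_cost W m) (map item_inst I ++ [::], [::]).
  rewrite cats0 /I map_cat; have -> // : map item_inst (tautologies n) = map cut_taut (orevkov_crits n).
  by rewrite /tautologies -map_comp; apply: eq_map => c; rewrite /= taut_item_inst.
have [|p [cf le_p]] := Der_closures (clos _ sall) _ d.
  rewrite !addn0; apply: leq_ltn_trans (_ : 2 * V * b < W); first by rewrite leq_mul2r szI orbT.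
  by rewrite /W /sequent_bound -/V -/b; lia.
have szts : sumn (map (fun it => (size it.2).+2) I) <= 2 * V * (V + 2).
  apply: leq_trans (@sumn_le_mul _ _ (V + 2) _ _) _; last by rewrite leq_mul2r szI orbT.
  by apply: All_seq_impl sall => it [_ ? _]; lia.
move: p cf le_p; rewrite cats0 map_comp => p cf le_p; exists p; split=> //.
apply: leq_trans le_p _; rewrite /proof_bound -/W leq_mul2r; apply/orP; right.
apply: leq_add; last by rewrite -/V; nia.
apply: leq_trans (tree_cost_le W m) _; apply: leq_mul.
  by rewrite /W /sequent_bound; lia.
by rewrite leq_exp2l // /W /sequent_bound -/V -/b /m; lia.
Qed.

(** * Lower bound for cut-free LK-proofs *)

Section FInduction.

Variables (P : fterm -> Prop).
Hypotheses (PVar : forall n, P (Var n)) (PFn : forall f ts, All_seq P ts -> P (Fn f ts)).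

Fixpoint fterm_induction (t : fterm) : P t :=
  let fix all ts : All_seq P ts :=
    match ts with [::] => I | t :: ts => conj (fterm_induction t) (all ts) end in
  match t with Var n => PVar n | Fn f ts => PFn f (all ts) end.

End FInduction.

(** Numerals get their usual value. All symbols add up their arguments, with 1 more for name 1, so
    with variables at 0 no term has a value above its size. *)
Fixpoint tval (s : nat -> nat) (t : fterm) : nat :=
  match t with
  | Var n => s n
  | Fn f ts => (f == 1) + sumn (map (tval s) ts)
  end.

Definition vcons (v : nat) (s : nat -> nat) (n : nat) : nat := if n is m.+1 then s m else v.

Lemma tval_subst t s r : tval s (tsubst r t) = tval (tval s \o r) t.
Proof.
elim/fterm_induction: t => //= f ts IH; congr (_ + sumn _).
by rewrite -map_comp; apply: All_seq_eq_map.
Qed.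

Lemma tval_size t : tval (fun=> 0) t <= fterm_size t.
Proof.
elim/fterm_induction: t => //= f ts IH.
suff: sumn (map (tval (fun=> 0)) ts) <= sumn (map fterm_size ts) by case: (f == 1); lia.
by elim: ts IH => //= t ts IHts [? /IHts]; lia.
Qed.

Section BoundedSemantics.

Variables (I : nat -> seq nat -> Prop) (K : nat).

(** Not a first-order structure: quantifiers stop at [K], while terms may take larger values.
    Instantiation is sound only for terms of value at most [K]. *)
Fixpoint bsat (s : nat -> nat) (A : fform) : Prop :=
  match A with
  | Atom p ts => I p (map (tval s) ts)
  | Neg A => ~ bsat s A
  | And A B => bsat s A /\ bsat s B
  | Or A B => bsat s A \/ bsat s B
  | Imp A B => bsat s A -> bsat s B
  | All A => forall v, v <= K -> bsat (vcons v s) A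
  | Ex A => exists2 v, v <= K & bsat (vcons v s) A
  end.

Lemma bsat_subst A s r : bsat s (fsubst r A) <-> bsat (tval s \o r) A.
Proof.
have tupE v (s' : nat -> nat) r' : tval (vcons v s') \o tup r' = vcons v (tval s' \o r').
  by apply: functional_extensionality => -[|n] //=; rewrite /tshift tval_subst.
elim: A s r => /= [p ts|A IH|A IHA B IHB|A IHA B IHB|A IHA B IHB|A IH|A IH] s r;
  rewrite ?IH ?IHA ?IHB //.
- suff -> : map (tval s) (map (tsubst r) ts) = map (tval (tval s \o r)) ts by [].
  by rewrite -map_comp; apply: eq_map => t; rewrite /= tval_subst.
- by split=> H v /H; rewrite IH tupE.
- by split=> -[v le_v H]; exists v => //; move: H; rewrite IH tupE.
Qed.

Lemma bsat_inst A s t : bsat s (inst A t) <-> bsat (vcons (tval s t) s) A.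
Proof.
rewrite bsat_subst (_ : _ \o _ = vcons (tval s t) s) //.
by apply: functional_extensionality => -[].
Qed.

Definition agree_off (j : nat) (s s' : nat -> nat) : Prop := forall i, i <> j -> s i = s' i.

(** Either variable [j] occurs, so that the term replacing it is contained in the result, or the
    value does not depend on it. *)
Definition size_or_irrelevant (r : nat -> fterm) (j : nat) (t : fterm) : Prop :=
  fterm_size (r j) <= fterm_size (tsubst r t) \/
  forall s s', agree_off j s s' -> tval s t = tval s' t.

Lemma seq_size_or_irrelevant r j ts : All_seq (size_or_irrelevant r j) ts ->
  fterm_size (r j) <= sumn (map fterm_size (map (tsubst r) ts)) \/
  forall s s', agree_off j s s' -> map (tval s) ts = map (tval s') ts.
Proof.
elim: ts => [|t ts IH] /=; first by right.
move=> [[le_t|eq_t] /IH[le_ts|eq_ts]]; try by left; lia.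
by right=> s s' ss'; rewrite (eq_t _ _ ss') (eq_ts _ _ ss').
Qed.

Lemma tsubst_size_or_irrelevant r j t : size_or_irrelevant r j t.
Proof.
elim/fterm_induction: t => /= [n|f ts /seq_size_or_irrelevant[le|eq]].
- rewrite /size_or_irrelevant /=.
  by have [->|/eqP nj] := eqVneq n j; [left | right=> s s'; apply].
- by left; apply: leqW.
- by right=> s s' /= /eq ->.
Qed.

Lemma fsubst_size_or_irrelevant A r j :
  fterm_size (r j) <= fform_size (fsubst r A) \/
  forall s s', agree_off j s s' -> (bsat s A <-> bsat s' A).
Proof.
have tup_size r' i : fterm_size (tup r' i.+1) = fterm_size (r' i).
  rewrite /= /tshift; elim/fterm_induction: (r' i) => //= f ts IH.
  by congr (sumn _).+1; rewrite -map_comp; apply: All_seq_eq_map.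
have agreeS v i s s' : agree_off i s s' -> agree_off i.+1 (vcons v s) (vcons v s').
  by move=> ss' [|n] //= ni; apply: ss'; lia.
elim: A r j => /= [p ts|A IH|A IHA B IHB|A IHA B IHB|A IHA B IHB|A IH|A IH] r j.
- have [|le|eq] := @seq_size_or_irrelevant r j ts.
  + by elim: (ts) => //= t us IH; split=> //; apply: tsubst_size_or_irrelevant.
  + by left; apply: leqW.
  + by right=> s s' /eq ->.
- have [le|eq] := IH r j; first by left; lia.
  by right=> s s' /eq ->.
- have [le|eqA] := IHA r j; first by left; lia.
  have [le|eqB] := IHB r j; first by left; lia.
  by right=> s s' ss'; rewrite (eqA _ _ ss') (eqB _ _ ss').
- have [le|eqA] := IHA r j; first by left; lia.
  have [le|eqB] := IHB r j; first by left; lia.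
  by right=> s s' ss'; rewrite (eqA _ _ ss') (eqB _ _ ss').
- have [le|eqA] := IHA r j; first by left; lia.
  have [le|eqB] := IHB r j; first by left; lia.
  by right=> s s' ss'; rewrite (eqA _ _ ss') (eqB _ _ ss').
- have [le|eq] := IH (tup r) j.+1; first by left; rewrite tup_size in le; lia.
  right=> s s' ss'; have {}eq v := eq _ _ (agreeS v _ _ _ ss').
  by split=> H v /H /eq.
- have [le|eq] := IH (tup r) j.+1; first by left; rewrite tup_size in le; lia.
  right=> s s' ss'; have {}eq v := eq _ _ (agreeS v _ _ _ ss').
  by split=> -[v le_v /eq H]; exists v.
Qed.

Lemma weak_only_subst A pos r : weak_only pos (fsubst r A) = weak_only pos A.
Proof.
by elim: A pos r => //= [A IHA B IHB|A IHA B IHB|A IHA B IHB|A IH|A IH] pos r;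
  rewrite ?IHA ?IHB ?IH.
Qed.

Lemma weak_only_inst A t pos : weak_only pos (inst A t) = weak_only pos A.
Proof. exact: weak_only_subst. Qed.

(* In a cut-free proof with weak quantifiers, every witness term either occurs
   in the premise, hence has value at most [K], or instantiates a quantifier
   that binds nothing. *)
Lemma bsat_witness A t : fform_size (inst A t) <= K ->
  exists2 v, v <= K & (bsat (fun=> 0) (inst A t) <-> bsat (vcons v (fun=> 0)) A).
Proof.
move=> le_K; have [le|irr] := @fsubst_size_or_irrelevant A (fun n => if n is m.+1 then Var m else t) 0.
  exists (tval (fun=> 0) t); last exact: bsat_inst.
  exact: leq_trans (tval_size t) (leq_trans le le_K).
exists 0 => //; rewrite bsat_inst; apply: irr.
by case.
Qed.

Lemma LK_size_ge S (p : LK S) : sequent_size fform_size S <= LK_size p.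
Proof. by case: p => *; rewrite /= leq_addr. Qed.

Lemma all_perm (T : Type) (a : pred T) s s' : Permutation s s' -> all a s = all a s'.
Proof. by elim=> //= [x ? ? _ -> //|x y ?|? ? ? _ -> _ ->]; rewrite // andbCA. Qed.

Ltac weak_premise IH cf le_K :=
  let w := fresh "w" in intro w; lapply (IH cf le_K);
  [ clear IH; intro IH; simpl in IH; revert w
  | revert w; clear; rewrite /= ?all_cat ?weak_only_inst;
    repeat match goal with
    | |- context [weak_only ?b ?A] => destruct (weak_only b A)
    | |- context [all ?a ?G] => destruct (all a G)
    end; by []].

(** Without cuts, premises inherit weak quantifiers from the conclusion, and [bsat_witness]
    justifies the two weak rules because every premise is no larger than the proof. Free variables
    are read as 0. *)
Lemma LK_bounded_sound S (p : LK S) :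
    LK_cut_free p -> LK_size p <= K -> weak_quantifiers_only S ->
  All_seq (bsat (fun=> 0)) S.1 -> Some_seq (bsat (fun=> 0)) S.2.
Proof.
have Some_cat (P : fform -> Prop) s s' : Some_seq P (s ++ s') <-> Some_seq P s \/ Some_seq P s'.
  by elim: s => //= [|x s IH]; tauto.
have witness A t G D (q : LK (G, D)) : LK_size q <= K ->
    List.In (inst A t) G \/ List.In (inst A t) D ->
  exists2 v, v <= K & (bsat (fun=> 0) (inst A t) <-> bsat (vcons v (fun=> 0)) A).
  move=> le_q A_in; apply: bsat_witness; apply: leq_trans le_q; apply: leq_trans (LK_size_ge q).
  have In_le G' : List.In (inst A t) G' -> fform_size (inst A t) <= sumn (map fform_size G').
    by elim: G' => //= B G' IH [->|/IH]; lia.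
  by rewrite /sequent_size /=; case: A_in => /In_le; lia.
rewrite /weak_quantifiers_only.
elim: p => {S} /=
  [A|G G' D D' pG pD p IH|A G D p IH|A G D p IH|A G D p IH|A G D p IH|//
  |A G D p IH|A G D p IH|A B G D p IH|A B G D p IH|A B G D P L p IHp q IHq
  |A B G D P L p IHp q IHq|A B G D p IH|A B G D p IH|A B G D P L p IHp q IHq
  |A B G D p IH|A t G D p IH|A G D p IH|A G D p IH|A t G D p IH] cf le_K;
  (* The conclusions of both strong quantifier rules violate [weak_only], so these cases disappear
     here. *)
  rewrite ?all_cat //= ?andbT ?andbF //.
- by move=> _ [?]; left.
- rewrite -(all_perm _ pG) -(all_perm _ pD) => w /(All_seq_perm (Permutation_sym pG)) H.
  by apply: (Some_seq_perm pD); apply: IH => //; lia.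
- by weak_premise IH cf (leq_trans (leq_addl _ _) le_K); move: IH; clear; tauto.
- by weak_premise IH cf (leq_trans (leq_addl _ _) le_K); move: IH; clear; tauto.
- by weak_premise IH cf (leq_trans (leq_addl _ _) le_K); move: IH; clear; tauto.
- by weak_premise IH cf (leq_trans (leq_addl _ _) le_K); move: IH; clear; tauto.
- by weak_premise IH cf (leq_trans (leq_addl _ _) le_K); move: IH; clear; tauto.
- by weak_premise IH cf (leq_trans (leq_addl _ _) le_K); move: IH; clear; have := classic (bsat (fun=> 0) A); tauto.
- by weak_premise IH cf (leq_trans (leq_addl _ _) le_K); move: IH; clear; tauto.
- by weak_premise IH cf (leq_trans (leq_addl _ _) le_K); move: IH; clear; tauto.
- weak_premise IHp (andP cf).1 (leq_trans (leq_trans (leq_addr _ _) (leq_addl _ _)) le_K).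
  weak_premise IHq (andP cf).2 (leq_trans (leq_trans (leq_addl _ _) (leq_addl _ _)) le_K).
  by rewrite All_seq_cat Some_cat; move: IHp IHq; clear; tauto.
- weak_premise IHp (andP cf).1 (leq_trans (leq_trans (leq_addr _ _) (leq_addl _ _)) le_K).
  weak_premise IHq (andP cf).2 (leq_trans (leq_trans (leq_addl _ _) (leq_addl _ _)) le_K).
  by rewrite All_seq_cat Some_cat; move: IHp IHq; clear; tauto.
- by weak_premise IH cf (leq_trans (leq_addl _ _) le_K); move: IH; clear; tauto.
- by weak_premise IH cf (leq_trans (leq_addl _ _) le_K); move: IH; clear; tauto.
- weak_premise IHp (andP cf).1 (leq_trans (leq_trans (leq_addr _ _) (leq_addl _ _)) le_K).
  weak_premise IHq (andP cf).2 (leq_trans (leq_trans (leq_addl _ _) (leq_addl _ _)) le_K).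
  by rewrite All_seq_cat Some_cat; move: IHp IHq; clear; tauto.
- weak_premise IH cf (leq_trans (leq_addl _ _) le_K); move: IH; clear.
  by have := classic (bsat (fun=> 0) A); tauto.
- have [|v le_v vE] := witness A t _ _ p (leq_trans (leq_addl _ _) le_K); first by left; left.
  weak_premise IH cf (leq_trans (leq_addl _ _) le_K) => _ [HA HG].
  by apply: IH; split=> //; apply/vE/HA.
- have [|v le_v vE] := witness A t _ _ p (leq_trans (leq_addl _ _) le_K); first by right; left.
  weak_premise IH cf (leq_trans (leq_addl _ _) le_K) => _ /IH[/vE HA|]; last by right.
  by left; exists v.
Qed.

End BoundedSemantics.

(** * The tower model of the axioms *)

Definition tower (n : nat) : nat := exps n 0.

Lemma towerS n : tower n.+1 = 2 ^ tower n.
Proof. by []. Qed.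

(** Mark i holds only of the number reached from 0 after n - i exponentiations, the least reading
    that the start and link axioms allow. *)
Definition tower_model (n : nat) (p : nat) (vs : seq nat) : Prop :=
  match p, vs with
  | 0, [:: x; w; z] => x + 2 ^ w = z
  | i.+1, [:: z] => z = tower (n - i)
  | _, _ => False
  end.

Lemma bsat_closure I K G k : (forall s, bsat I K s G) -> forall s, bsat I K s (iter k All G).
Proof. by move=> HG; elim: k => //= k IH s v _. Qed.

Lemma tautologies_sat I K n s :
  All_seq (bsat I K s) (map item_closure (tautologies n)).
Proof.
rewrite /tautologies; elim: (orevkov_crits n) => //= c C IH; split=> //.
by apply: bsat_closure => s' /=.
Qed.

Lemma zero_items_sat n K s i :
  All_seq (bsat (tower_model n) K s) (map item_closure (zero_items i)).
Proof.
have comp x w u z : bsat (tower_model n) K s (item_closure (comp_item x w u z)).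
  by apply: bsat_closure => s' /= <- <-; rewrite add1n addn0 expnS; lia.
have succ x : bsat (tower_model n) K s (item_closure (succ_item x)).
  by apply: bsat_closure => s' /=; rewrite expn0; lia.
by case: i => [|[|i]].
Qed.

Lemma chain_items_sat n K s i w : K < tower n -> i <= n ->
  All_seq (bsat (tower_model n) K s) (map item_closure (chain_items i w)).
Proof.
move=> lt_K; elim: i w => [|i IH] w le_i.
  (* Only the stop axiom is false over all naturals; its one counterexample, the tower itself, lies
     beyond [K]. *)
  by split=> //= v le_v; rewrite subn0 => eq_v; move: le_v; rewrite eq_v leqNgt lt_K.
have -> : chain_items i.+1 w = link_item i w (ex_wit i ezero w) :: (zero_items i ++
  chain_items i (ex_wit i ezero w)) by [].
rewrite map_cons; split.
  apply: bsat_closure => s' /= -> <-; rewrite add0n -towerS; congr tower; lia.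
by rewrite map_cat; apply/All_seq_cat; split; [apply: zero_items_sat | apply: IH; lia].
Qed.

Lemma orevkov_items_sat n K s : K < tower n ->
  All_seq (bsat (tower_model n) K s) (map item_closure (orevkov_items n)).
Proof.
move=> lt_K; rewrite /orevkov_items map_cat; apply/All_seq_cat; split.
  split; first by rewrite /item_closure /= subnn.
  (* Closures forget the instantiating terms, so the idle pair has the same closures as
     [zero_items 2]. *)
  exact: (zero_items_sat n K s 2).
rewrite map_cat; apply/All_seq_cat; split; first exact: zero_items_sat.
exact: chain_items_sat.
Qed.

Lemma weak_only_closure k G : weak_only false G -> weak_only false (iter k All G).
Proof. by move=> wG; elim: k. Qed.

Lemma weak_only_skeleton k A pos : weak_only pos (eform_skeleton k A).
Proof.
by elim: A k pos => //= [A IHA B IHB|A IHA B IHB|A IHA B IHB] k pos; rewrite IHA IHB.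
Qed.

Lemma orevkov_weak n : weak_quantifiers_only (orevkov_sequent n).
Proof.
rewrite /weak_quantifiers_only /orevkov_sequent /= andbT map_cat all_cat; apply/andP; split.
  rewrite /tautologies; elim: (orevkov_crits n) => //= c C ->; rewrite andbT.
  by apply: weak_only_closure; rewrite /= !weak_only_skeleton.
have zero i : all (weak_only false) (map item_closure (zero_items i)) by case: i => [|[|i]].
rewrite /orevkov_items !map_cat !all_cat zero /=.
elim: n ezero => //= n IH w.
by rewrite map_cat all_cat zero IH.
Qed.

Lemma orevkov_lower_bound n (p : LK (orevkov_sequent n)) :
  LK_cut_free p -> tower n <= LK_size p.
Proof.
move=> cf; rewrite leqNgt; apply/negP => lt_p.
have [] := LK_bounded_sound (I := tower_model n) cf (leqnn _) (orevkov_weak n).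
rewrite /= map_cat; apply/All_seq_cat; split; first exact: tautologies_sat.
exact: orevkov_items_sat.
Qed.

(** * Existence of cut-free LK-proofs *)

Definition LK_derivable (S : sequent fform) : Prop := exists p : LK S, LK_cut_free p.

Lemma LK_derivable_perm G G' D : Permutation G G' -> LK_derivable (G, D) -> LK_derivable (G', D).
Proof. by move=> pG [p cf]; exists (LK_exch pG (Permutation_refl D) p). Qed.

Lemma LK_derivable_weaken G G' D : LK_derivable (G, D) -> LK_derivable (G' ++ G, D).
Proof.
by move=> d; elim: G' => //= A G' [p cf]; exists (LK_wl A p).
Qed.

Lemma LK_derivable_absorb A G D : List.In A G -> LK_derivable (A :: G, D) -> LK_derivable (G, D).
Proof.
move=> A_G; have [G' pG] := In_perm A_G => d; apply: (LK_derivable_perm pG).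
have [p cf] := LK_derivable_perm (perm_skip A (Permutation_sym pG)) d.
by exists (LK_cl p).
Qed.

Lemma LK_derivable_merge G G' D : (forall A, List.In A G -> List.In A G') ->
  LK_derivable (G ++ G', D) -> LK_derivable (G', D).
Proof.
elim: G => //= A G IH sub d; apply: IH => [B B_G|]; first by apply: sub; right.
by apply: LK_derivable_absorb d; apply: In_cat_r; apply: sub; left.
Qed.

Lemma LK_derivable_id A G : List.In A G -> LK_derivable (G, [:: A]).
Proof.
move=> A_G; have [G' pG] := In_perm A_G; apply: (LK_derivable_perm pG).
have d : LK_derivable (G' ++ [:: A], [:: A]).
  by apply: LK_derivable_weaken; exists (LK_ax A).
by apply: LK_derivable_perm d; have := perm_cat_cons A G' [::]; rewrite cats0.
Qed.

Lemma LK_derivable_horn A B C G :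
  LK_derivable (G, [:: A]) -> LK_derivable (G, [:: B]) ->
  LK_derivable (Imp A (Imp B C) :: G, [:: C]).
Proof.
move=> [p cfp] [q cfq]; apply: (@LK_derivable_merge G) => [D|]; first by right.
have [r cfr] : LK_derivable (Imp A (Imp B C) :: G ++ G ++ [::], [:: C]).
  by exists (LK_impl p (LK_impl q (LK_ax C))); rewrite /= cfp cfq.
rewrite cats0 in r cfr; apply: LK_derivable_perm (ex_intro _ r cfr).
exact/Permutation_sym/perm_cat_cons.
Qed.

Lemma LK_derivable_all A t G D :
  LK_derivable (inst A t :: G, D) -> LK_derivable (All A :: G, D).
Proof. by move=> [p cf]; exists (LK_alll p). Qed.

Definition numeral (k : nat) : fterm := iter k fsucc fzero.

Lemma tsubst_numeral s k : tsubst s (numeral k) = numeral k.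
Proof. by elim: k => //= k ->. Qed.

Lemma tshift_numeral k : tshift (numeral k) = numeral k.
Proof. exact: tsubst_numeral. Qed.

Section Existence.

Variable n : nat.

Let G := (orevkov_sequent n).1.

Lemma closure_in it : List.In it (orevkov_items n) -> List.In (item_closure it) G.
Proof.
move=> it_in; rewrite /G /= map_cat; apply: In_cat_r.
by elim: (orevkov_items n) it_in => //= x s IH [->|/IH]; [left | right].
Qed.

Lemma link_in i : i < n -> exists w z, List.In (link_item i w z) (orevkov_items n).
Proof.
move=> lt_i; suff [w [z H]] : exists w z, List.In (link_item i w z) (chain_items n ezero).
  by exists w, z; apply: In_cat_r; apply: In_cat_r.
elim: n ezero lt_i => // m IH x; rewrite ltnS leq_eqVlt => /predU1P[->|/IH H].
  by exists x, (ex_wit m ezero x); left.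
have [w [z H']] := H (ex_wit m ezero x); exists w, z.
exact: or_intror (In_cat_r _ H').
Qed.

Lemma stop_in : exists w, List.In (stop_item w) (orevkov_items n).
Proof.
suff [w H] : exists w, List.In (stop_item w) (chain_items n ezero).
  by exists w; apply: In_cat_r; apply: In_cat_r.
elim: n ezero => [|m IH] x; first by exists x; left.
by have [w H] := IH (ex_wit m ezero x); exists w; exact: or_intror (In_cat_r _ H).
Qed.

(** Induction on [y] for all [x]: the hypothesis is used at [x] and at [x + 2 ^ y], and the two
    results are composed. *)
Lemma LK_power x y :
  LK_derivable (G, [:: fpow (numeral x) (numeral y) (numeral (x + 2 ^ y))]).
Proof.
elim: y x => [|y IH] x.
  apply: LK_derivable_absorb (closure_in (it := succ_item ezero) _) _; first by right; left.
  apply: (@LK_derivable_all _ (numeral x)).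
  by rewrite addn1; apply: LK_derivable_id; left.
apply: LK_derivable_absorb (closure_in (it := comp_item ezero ezero ezero ezero) _) _.
  by right; right; left.
(* The outermost quantifier binds the variable of highest index, so the terms are supplied in the
   order z, u, w, x. *)
apply: (@LK_derivable_all _ (numeral (x + 2 ^ y.+1))).
rewrite /inst /= !tshift_numeral; apply: (@LK_derivable_all _ (numeral (x + 2 ^ y))).
rewrite /inst /= !tshift_numeral !tsubst_numeral; apply: (@LK_derivable_all _ (numeral y)).
rewrite /inst /= !tshift_numeral !tsubst_numeral; apply: (@LK_derivable_all _ (numeral x)).
rewrite /inst /= !tsubst_numeral.
apply: LK_derivable_horn; first exact: IH.
by have := IH (x + 2 ^ y); rewrite -addnA addnn -mul2n -expnS.
Qed.

Lemma LK_mark j : j <= n -> LK_derivable (G, [:: fmark (n - j) (numeral (tower j))]).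
Proof.
elim: j => [|j IH] le_j.
  apply: LK_derivable_id; rewrite subn0.
  by apply: (closure_in (it := start_item n)); left.
have [|w [z link]] := @link_in (n - j.+1); first by lia.
apply: LK_derivable_absorb (closure_in link) _.
apply: (@LK_derivable_all _ (numeral (2 ^ tower j))).
rewrite /inst /= !tshift_numeral; apply: (@LK_derivable_all _ (numeral (tower j))).
rewrite /inst /= !tsubst_numeral; apply: LK_derivable_horn.
  by have := IH (ltnW le_j); rewrite subnSK.
exact: LK_power 0 (tower j).
Qed.

Lemma orevkov_LK : LK_derivable (orevkov_sequent n).
Proof.
have [w stop] := stop_in; apply: LK_derivable_absorb (closure_in stop) _.
apply: (@LK_derivable_all _ (numeral (tower n))).
have [p cf] := LK_mark (leqnn n); rewrite subnn in p cf.
by exists (LK_negl p).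
Qed.

End Existence.

(** * Growth rates *)

Definition exps_bounded (g : nat -> nat) : Prop := exists k, forall n, g n <= exps k n.

Lemma exps_bounded_le g h : (forall n, g n <= h n) -> exps_bounded h -> exps_bounded g.
Proof. by move=> le_gh [k hk]; exists k => n; apply: leq_trans (le_gh n) (hk n). Qed.

Lemma exps_bounded_id : exps_bounded id.
Proof. by exists 0. Qed.

Lemma leq_tower n : n <= tower n.
Proof. by elim: n => // n IH; rewrite towerS; apply: leq_ltn_trans IH (ltn_expl _ _). Qed.

Lemma exps_bounded_const c : exps_bounded (fun=> c).
Proof. by exists c => n; apply: leq_trans (leq_tower c) (leq_exps c (leq0n n)). Qed.

Lemma exps_bounded2 g h : exps_bounded g -> exps_bounded h ->
  exists k, forall n, g n <= exps k n /\ h n <= exps k n.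
Proof.
move=> [k gk] [l hl]; exists (k + l) => n; split.
  exact: leq_trans (gk n) (leq_expsl _ (leq_addr _ _)).
exact: leq_trans (hl n) (leq_expsl _ (leq_addl _ _)).
Qed.

Lemma exps_bounded_mul g h : exps_bounded g -> exps_bounded h ->
  exps_bounded (fun n => g n * h n).
Proof.
move=> bg bh; have [k gh] := exps_bounded2 bg bh; exists (2 + k) => n.
have [gk hk] := gh n; rewrite exps_add; apply: leq_trans (leq_mul gk hk) _.
exact/ltnW/sqr_le_exps2.
Qed.

Lemma exps_bounded_add g h : exps_bounded g -> exps_bounded h ->
  exps_bounded (fun n => g n + h n).
Proof.
move=> bg bh; have [k gh] := exps_bounded2 bg bh; exists (2 + k) => n.
have [gk hk] := gh n; rewrite exps_add; apply: leq_trans (leq_add gk hk) _.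
have := sqr_le_exps2 (exps k n); have := exps2_add2 (exps k n).
by move: (exps k n) => z; move: (exps 2 z) => w; case: z => [|[|z]]; nia.
Qed.

Lemma exps_bounded_exp g h : exps_bounded g -> exps_bounded h ->
  exps_bounded (fun n => g n ^ h n).
Proof.
move=> bg bh; have [k gh] := exps_bounded2 bg bh; exists (3 + k) => n.
have [gk hk] := gh n; rewrite exps_add.
apply: (@leq_trans ((2 ^ exps k n) ^ exps k n)).
  apply: (@leq_trans ((2 ^ exps k n) ^ h n)); last by rewrite leq_pexp2l ?expn_gt0.
  by case: (h n) => // j; rewrite leq_exp2r //; apply: leq_trans gk (leq_exp2n _).
by rewrite -expnM [exps 3 _]/= leq_exp2l //; apply/ltnW/sqr_le_exps2.
Qed.

Lemma proof_bound_exps : exps_bounded proof_bound.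
Proof.
have lin : exps_bounded S.
  apply: exps_bounded_le (exps_bounded_add exps_bounded_id (exps_bounded_const 1)) => n.
  by rewrite addn1.
have level : exps_bounded level_bound.
  apply: exps_bounded_exp (exps_bounded_const _) _.
  exact: exps_bounded_exp (exps_bounded_const _) exps_bounded_id.
have orevkov : exps_bounded orevkov_bound.
  apply: exps_bounded_exp (exps_bounded_const _).
  apply: exps_bounded_add (exps_bounded_const _) _.
  exact: exps_bounded_mul (exps_bounded_mul (exps_bounded_const _) level) lin.
have closure : exps_bounded closure_bound.
  apply: (exps_bounded_mul _ orevkov); apply: exps_bounded_exp.
    exact: exps_bounded_add orevkov (exps_bounded_const _).
  exact: exps_bounded_exp (exps_bounded_const _) orevkov.
have sequent : exps_bounded sequent_bound.
  apply: exps_bounded_add (exps_bounded_const _).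
  apply: exps_bounded_mul (exps_bounded_const _) _.
  by apply: exps_bounded_add; apply: exps_bounded_mul.
apply: (exps_bounded_mul _ sequent); apply: exps_bounded_add.
  apply: exps_bounded_mul; first exact: exps_bounded_mul (exps_bounded_const _) sequent.
  exact: exps_bounded_exp (exps_bounded_const _) sequent.
apply: (exps_bounded_mul _ orevkov).
exact: exps_bounded_mul (exps_bounded_const _) orevkov.
Qed.

(** [tower (c + j)] is [exps c (tower j)], so it suffices that [tower j] exceeds [c + j] for some j.
    Raising c and j by one raises the sum by 2 and the tower by at least 2. *)
Lemma tower_not_exps_bounded : ~ exps_bounded tower.
Proof.
case=> c tc.
suff [j [_ ge_j]] : exists j, 3 <= tower j /\ (c + j).+1 <= tower j.
  have := tc (c + j); rewrite {1}/tower exps_add leqNgt.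
  move/negP; apply; suff mono x y : x < y -> exps c x < exps c y by apply: mono.
  by move=> lt_xy; elim: c {tc ge_j} => //= c IH; rewrite ltn_exp2l.
elim: c {tc} => [|c [j [ge3 ge_j]]]; first by exists 3.
exists j.+1; rewrite towerS.
have : tower j + 2 <= 2 ^ tower j.
  case: (tower j) ge3 => // t; rewrite expnS; have := ltn_expl t (ltnSn 1).
  by move: (2 ^ t); lia.
by lia.
Qed.

(** An approximate inverse of [exps k]. The maximum over an empty range is 0, which explains the
    summand [exps k 0] in [slow_le]. *)
Definition slow (k i : nat) : nat := \max_(n < i.+1 | exps k n <= i) n.

Lemma slow_le k i : exps k (slow k i) <= i + exps k 0.
Proof.
rewrite /slow; elim/big_ind: _ => [|m n le_m le_n|n le_n]; first exact: leq_addl.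
  by rewrite /maxn; case: ifP.
exact: leq_trans le_n (leq_addr _ _).
Qed.

Lemma slow_ge k n : n <= slow k (exps k n).
Proof.
have lt_n : n < (exps k n).+1 by rewrite ltnS exps_ge.
by have := @leq_bigmax_cond _ (fun m : 'I__ => exps k m <= exps k n) (fun m => m : nat) (Ordinal lt_n) (leqnn _).
Qed.

Lemma exists_minimum (P : nat -> Prop) : (exists n, P n) ->
  exists m, P m /\ forall n, P n -> m <= n.
Proof.
case=> n; have [k] := ubnP n; elim: k n => // k IH n lt_n Pn.
have [[j [lt_j Pj]]|no] := classic (exists j, j < n /\ P j).
  by apply: IH Pj; lia.
exists n; split=> // j Pj; rewrite leqNgt; apply/negP => lt_j.
by apply: no; exists j.
Qed.

(** * Assembly of the sequence *)

Theorem theorem2 :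
  exists (S : nat -> sequent eform) (psi : forall i : nat, Leps (S i))
         (S' : nat -> sequent fform),
    (forall i : nat, Leps_cut_free (psi i)) /\
    poly_bounded (fun i : nat => sequent_size eform_size (S i)) /\
    (forall i : nat, S i = eps_sequent (S' i) /\ weak_quantifiers_only (S' i)) /\
    poly_bounded (fun i : nat => Leps_size (psi i)) /\
    exists m : nat -> nat,
      (forall i : nat, min_cut_free_LK_size (S' i) (m i)) /\
      ~ (exists f : nat -> nat, elementary f /\ forall i : nat, m i <= f i).
Proof.
have [k le_k] := proof_bound_exps.
(* With this index, proofs bounded by [exps k] have size at most i plus a constant. *)
pose S' i := orevkov_sequent (slow k i).
pose P i := constructive_indefinite_description _ (orevkov_Leps (slow k i)).
pose psi i : Leps (eps_sequent (S' i)) := proj1_sig (P i).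
have cf i : Leps_cut_free (psi i) by have [] := proj2_sig (P i).
have size_psi i : Leps_size (psi i) <= i + exps k 0.
  have [_ le_p] := proj2_sig (P i).
  exact: leq_trans le_p (leq_trans (le_k _) (slow_le k i)).
have linear (g : nat -> nat) : (forall i, g i <= i + exps k 0) -> poly_bounded g.
  by move=> le_g; exists ('X + (exps k 0)%:P)%R => i; rewrite hornerD hornerX hornerC.
have min i : exists m, min_cut_free_LK_size (S' i) m.
  have [|m [[p cfp <-] le_m]] := @exists_minimum
      (fun m => exists2 p : LK (S' i), LK_cut_free p & LK_size p = m).
    by have [p cfp] := orevkov_LK (slow k i); exists (LK_size p), p.
  by exists (LK_size p); split; [exists p | move=> q cfq; apply: le_m; exists q].
exists (fun i => eps_sequent (S' i)), psi, S'; split=> //; split; last split; last split.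
(* The end-sequent is counted in the size of its proof. *)
- apply: linear => i; apply: leq_trans (size_psi i).
  by case: (psi i) => *; rewrite /= leq_addr.
- by move=> i; split=> //; apply: orevkov_weak.
- exact: linear.
pose m i := proj1_sig (constructive_indefinite_description _ (min i)).
have mP i : min_cut_free_LK_size (S' i) (m i) := proj2_sig (constructive_indefinite_description _ (min i)).
exists m; split=> // -[f [/elementary_bound[l lt_f] le_f]].
(* At argument [exps k n] the index is at least n, so [tower n] would lie below f at [exps k n],
   hence below [exps (l + k) n]. *)
apply: tower_not_exps_bounded; exists (l + k) => n; rewrite exps_add.
apply: leq_trans (ltnW (lt_f _)); apply: leq_trans (le_f _).
have [[p cfp <-] _] := mP (exps k n).
apply: leq_trans (orevkov_lower_bound cfp).
by rewrite /tower; apply: leq_expsl; apply: slow_ge.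
Qed.
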